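(* There exists a positive constant $\mathcal{C}^*$ not depending on $\beta$ such that, for every $\beta>0$ and every initial state $(Q_1(0),Q_2(0))=(x,y)$ with $x\le 0$, $y>0$, almost surely \[ -2\sqrt{2} \le \liminf_{t \to \infty} \frac{Q_1(t)}{\sqrt{\log t}} \le -1,\qquad \frac{1}{\beta} \le \limsup_{t \to \infty} \frac{Q_2(t)}{\log t} \le \frac{2}{\mathcal{C}^* \beta}. \]
   Context: Fix $\beta>0$. For an initial state $(x,y)$ with $x\le 0$, $y\ge 0$, let $(Q_1,Q_2)$ be the continuous process on $[0,\infty)$ solving \[ Q_1(t) = x + \sqrt{2}W(t) - \beta t + \int_0^t(-Q_1(s)+Q_2(s))\,ds - L(t),\qquad Q_2(t) = y + L(t) - \int_0^t Q_2(s)\,ds, \] where $W$ is a standard Brownian motion and $L$ is the unique nondecreasing nonnegative càdlàg process with $L(0)=0$ such that $Q_1(t)\le 0$ for all $t$ and $\int_0^\infty \mathbf{1}_{[Q_1(t)<0]}\,dL(t)=0$. *)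

(* Defs.v *)
From HB Require Import structures.
From mathcomp Require Import all_boot all_order all_algebra.
From mathcomp Require Import all_classical all_reals all_analysis.
Set Implicit Arguments. Unset Strict Implicit. Unset Printing Implicit Defensive.
Import Order.TTheory GRing.Theory Num.Theory.
Import numFieldNormedType.Exports.
Local Open Scope classical_set_scope.
Local Open Scope ring_scope.

(* Standard Brownian motion on [0,oo) over a probability space (T, P):
   each W t is a random variable, W 0 = 0, every path is continuous on
   [0,oo), and for all times 0 <= t_0 < t_1 < ... < t_n and Borel sets
   A_0,...,A_{n-1}, the increments W(t_{i+1}) - W(t_i) are independent with
   law N(0, t_{i+1} - t_i) (normal_prob takes the standard deviation). *)
Definition std_brownian_motion (R : realType) (d : measure_display)
  (T : measurableType d) (P : probability T R) (W : R -> T -> R) : Prop :=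
  [/\ (forall t, measurable_fun setT (W t)),
      (forall w, W 0 w = 0),
      (forall w, {within `[0, +oo[, continuous (fun t => W t w)}) &
      (forall (n : nat) (t : nat -> R) (A : nat -> set R),
          0 <= t 0%N ->
          (forall i, (i < n)%N -> t i < t i.+1) ->
          (forall i, measurable (A i)) ->
          P (\bigcap_(i in [set k | (k < n)%N])
               [set w | W (t i.+1) w - W (t i) w \in A i])
          = (\prod_(i < n) normal_prob 0 (Num.sqrt (t i.+1 - t i)) (A i))%E)].

Definition reflected_solution (R : realType) (beta x y : R)
  (wpath q1 q2 l : R -> R) : Prop :=
  {within `[0, +oo[, continuous q1} /\
  {within `[0, +oo[, continuous q2} /\
  (forall t, 0 <= t ->
     q1 t = x + Num.sqrt 2 * wpath t - beta * t
            + Rintegral lebesgue_measure `[0, t] (fun s => - q1 s + q2 s)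
            - l t) /\
  (forall t, 0 <= t ->
     q2 t = y + l t - Rintegral lebesgue_measure `[0, t] q2) /\
  l 0 = 0 /\
  (forall s t, 0 <= s -> s <= t -> l s <= l t) /\
  (forall t, 0 <= t -> 0 <= l t) /\
  (forall t, 0 <= t -> l @ at_right t --> l t) /\
  (forall t, 0 < t -> cvg (l @ at_left t)) /\
  (forall t, 0 <= t -> q1 t <= 0) /\
  (exists F : cumulative R R,
     [/\ (forall t, 0 <= t -> F t = l t),
         (forall t, t < 0 -> F t = 0) &
         (\int[lebesgue_stieltjes_measure F]_(t in `[0%R, +oo[)
              (\1_[set s | q1 s < 0] t)%:E = 0)%E]).

(* Main.v *)
(**
Write b = sqrt 2 W and S = Q1 + Q2. The reflection term cancels in
dS = db - beta dt - Q1 dt, and Q1 <= S <= Q2. Everything reduces to estimates on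
single Brownian increments combined with pathwise arguments.

Liminf of Q1 from below: almost surely, up to time t ~ exp n, increments satisfy
|b(v) - b(u)| <= a (1 + v - u) with a slightly below sqrt 2 * sqrt n. Starting from the
last time where - Q1 <= a, the mean reversion compensates the linear term and
- Q1 <= 2 a.

Limsup of Q2 from above: suppose that |b(v) - b(u)| is at most of order
sqrt ((v - u) lam), up to a small additive constant. While Q2 exceeds a level of
order lam / beta, its upward push keeps - Q1 <= beta / 2, so that S has drift at
most - beta / 2 and cannot rise by more than O(lam / beta). Take lam = n at time exp n.

Limsup of Q2 from below: dS >= db - beta dt, and b rises by 2 k / beta in a
time k / beta^2 in one of about exp k disjoint windows.

Liminf of Q1 from above: with lam = k the same drift argument shows that S is o(k^2) at the
end of most windows of length k^8, and in one of exp (k^4) windows b then falls by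
almost 2 k^2 in a unit of time. If - Q1 stayed below k^2 meanwhile, S, hence Q1, would end
up below - k^2.

The two existence claims use a second moment argument, for which pairwise independence
of increments suffices.
*)

Require Import Defs.
From HB Require Import structures.
From mathcomp Require Import all_boot all_order all_algebra.
From mathcomp Require Import all_classical all_reals all_analysis.
From mathcomp Require Import measurable_realfun ring lra.
Import Order.TTheory GRing.Theory Num.Theory.
Import numFieldNormedType.Exports.
Local Open Scope classical_set_scope.
Local Open Scope ring_scope.

Set Implicit Arguments.
Unset Strict Implicit.
Unset Printing Implicit Defensive.

(** * Continuous paths on the half line *)

Section halfline_continuity.
Context {R : realType}.
Implicit Types f : R -> R.

(** Epsilon-delta form of continuity relative to the half line, one-sided at 0: values at negative
    times never enter. *)
Definition halfline_continuous f := forall t : R, 0 <= t -> forall e : R, 0 < e ->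
  exists2 d : R, 0 < d & forall s : R, 0 <= s -> `|s - t| < d -> `|f s - f t| < e.

Lemma within_halfline_continuous f :
  {within `[0, +oo[, continuous f} -> halfline_continuous f.
Proof.
move=> cf t t0 e e0.
have tI : `[0, +oo[%classic t by rewrite /= in_itv/= t0.
have /subspace_continuousP/(_ t tI) := cf.
move=> /cvgrPdist_lt /(_ e e0) [d /= d0 H].
exists d => // s s0 st; rewrite distrC; apply: H => /=.
  by rewrite /ball_/= distrC.
by rewrite in_itv/= s0.
Qed.

(** Marks the start of an excursion of [f] above [c]. By continuity the sublevel set is closed, so
    it contains its supremum. *)
Lemma last_time_le f (a b c : R) : halfline_continuous f ->
  0 <= a -> a <= b -> f a <= c ->
  exists u, [/\ a <= u, u <= b, f u <= c & forall v, u < v -> v <= b -> c < f v].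
Proof.
move=> cf a0 ab fac.
pose A := [set u | a <= u <= b /\ f u <= c].
have Aa : A a by split; rewrite // lexx.
have ubA : ubound A b by move=> u [/andP[]].
have hsA : has_sup A by split; [exists a|exists b].
have ua : a <= sup A by apply: sup_upper_bound.
have uB : sup A <= b by apply: ge_sup => //; exists a.
exists (sup A); split => //.
- rewrite leNgt; apply/negP => fu.
  have [|d d0 H] := cf (sup A) (le_trans a0 ua) (f (sup A) - c).
    by rewrite subr_gt0.
  have [s [/andP[sa sb] fs] su] := sup_adherent d0 hsA.
  have sle : s <= sup A by apply: sup_upper_bound => //; split=> //; apply/andP.
  have : `|s - sup A| < d by rewrite ler0_norm; lra.
  move=> /(H s (le_trans a0 sa)); rewrite ltr_norml; lra.
- move=> v uv vb; rewrite ltNge; apply/negP => fv.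
  have : v <= sup A.
    apply: sup_upper_bound => //; split=> //; apply/andP; split=> //.
    exact: le_trans ua (ltW uv).
  lra.
Qed.

Lemma Rintegral_increment f (u v : R) :
  {within `[0, +oo[, continuous f} -> 0 <= u -> u <= v ->
  Rintegral lebesgue_measure `[0, v] f - Rintegral lebesgue_measure `[0, u] f
  = Rintegral lebesgue_measure `]u, v] f /\
  lebesgue_measure.-integrable `]u, v] (EFin \o f).
Proof.
move=> cf u0 uv.
have cf' : {within `[0, v], continuous f}.
  apply: continuous_subspaceW cf => x /=; rewrite !in_itv/= => /andP[->]//.
have intf : lebesgue_measure.-integrable `[0, v] (EFin \o f).
  by apply: continuous_compact_integrable => //; apply: segment_compact.
split; first by rewrite Rintegral_itvB// ?bnd_simp.
apply: integrableS intf => // x /=; rewrite !in_itv/= => /andP[ux ->].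
by rewrite andbT (le_trans u0)// ltW.
Qed.

(** The bound is asked on []u, v]] only: after the last time [u] given by [last_time_le], it holds
    with [u] excluded. *)
Lemma Rintegral_increment_ge f (u v m : R) :
  {within `[0, +oo[, continuous f} -> 0 <= u -> u <= v ->
  (forall r, u < r -> r <= v -> m <= f r) ->
  m * (v - u) <=
  Rintegral lebesgue_measure `[0, v] f - Rintegral lebesgue_measure `[0, u] f.
Proof.
move=> cf u0 uv H; have [-> intf] := Rintegral_increment cf u0 uv.
have <- : Rintegral lebesgue_measure `]u, v] (cst m) = m * (v - u).
  rewrite Rintegral_cst//; congr (_ * _).
  have -> : v - u = fine (if (u%:E < v%:E)%E then (v%:E - u%:E)%E else 0%E).
    rewrite lte_fin; case: ltP => uv' //.
    by have -> : v = u by [apply/eqP; rewrite eq_le uv uv']; rewrite subrr.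
  exact: (congr1 fine (lebesgue_measure_itv `]u, v])).
apply: le_Rintegral => //; last first.
  by move=> x; rewrite /= in_itv/= => /andP[? ?]; apply: H.
apply/integrableP; split; first exact: measurable_cst.
rewrite integral_cst//=; have /= := lebesgue_measure_itv `]u, v].
by case: ifP => _ ->; rewrite -?EFinB -?EFinM ?mule0 ltry.
Qed.

Lemma Rintegral_increment_le f (u v m : R) :
  {within `[0, +oo[, continuous f} -> 0 <= u -> u <= v ->
  (forall r, u < r -> r <= v -> f r <= m) ->
  Rintegral lebesgue_measure `[0, v] f - Rintegral lebesgue_measure `[0, u] f
  <= m * (v - u).
Proof.
move=> cf u0 uv H.
have cNf : {within `[0, +oo[, continuous (fun x => - f x)}.
  by move=> x; apply: cvgN; exact: cf.
have := @Rintegral_increment_ge (fun x => - f x) u v (- m) cNf u0 uv.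
have oppI w : 0 <= w -> w <= v -> Rintegral lebesgue_measure `[0, w] (fun x => - f x) =
    - Rintegral lebesgue_measure `[0, w] f.
  move=> w0 wv; rewrite -[RHS]mulN1r -RintegralZl//.
    by apply: eq_Rintegral => x _; rewrite mulN1r.
  apply: continuous_compact_integrable; first exact: segment_compact.
  apply: continuous_subspaceW cf => x /=; rewrite !in_itv/= => /andP[->]//.
rewrite !oppI ?(le_trans u0 uv)//.
have H' r : u < r -> r <= v -> - m <= - f r by move=> a b; rewrite lerN2 H.
move=> /(_ H'); lra.
Qed.

End halfline_continuity.

(** * Pathwise estimates for the reflected system *)

Section reflected_paths.
Context {R : realType} (beta x y : R) (wp q1 q2 l : R -> R).
Context (sol : reflected_solution beta x y wp q1 q2 l).
Implicit Types (f : R -> R) (a b c m r s t u v lam theta : R).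

Local Notation s2 := (Num.sqrt (2 : R)).

Let cont1 : {within `[0, +oo[, continuous q1}.
Proof. by case: sol. Qed.

Let cont2 : {within `[0, +oo[, continuous q2}.
Proof. by case: sol => _ []. Qed.

Lemma q1_continuous : halfline_continuous q1.
Proof. exact: within_halfline_continuous. Qed.

Lemma q2_continuous : halfline_continuous q2.
Proof. exact: within_halfline_continuous. Qed.

Lemma q1_le0 t : 0 <= t -> q1 t <= 0.
Proof. by case: sol => _ [_ [_ [_ [_ [_ [_ [_ [_ [+ _]]]]]]]]]; apply. Qed.

Let q1E t : 0 <= t -> q1 t = x + s2 * wp t - beta * t
  + Rintegral lebesgue_measure `[0, t] (fun s => - q1 s + q2 s) - l t.
Proof. by case: sol => _ [_ [+ _]]; apply. Qed.

Let q2E t : 0 <= t -> q2 t = y + l t - Rintegral lebesgue_measure `[0, t] q2.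
Proof. by case: sol => _ [_ [_ [+ _]]]; apply. Qed.

Let l0 : l 0 = 0.
Proof. by case: sol => _ [_ [_ [_ [+ _]]]]. Qed.

Lemma l_nondecreasing s t : 0 <= s -> s <= t -> l s <= l t.
Proof. by case: sol => _ [_ [_ [_ [_ [+ _]]]]]; apply. Qed.

Lemma q1_start : q1 0 = x + s2 * wp 0.
Proof. by rewrite q1E// l0 set_itv1 Rintegral_set1; ring. Qed.

Lemma q2_start : q2 0 = y.
Proof. by rewrite q2E// l0 set_itv1 Rintegral_set1; ring. Qed.

Let integrable_path f t : {within `[0, +oo[, continuous f} ->
  lebesgue_measure.-integrable `[0, t] (EFin \o f : R -> \bar R).
Proof.
move=> cf; apply: continuous_compact_integrable; first exact: segment_compact.
by apply: continuous_subspaceW cf => z /=; rewrite !in_itv/= => /andP[->].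
Qed.

Let contN1 : {within `[0, +oo[, continuous (fun s => - q1 s)}.
Proof. by move=> z; apply: cvgN; exact: cont1. Qed.

Let sumE t : 0 <= t -> q1 t + q2 t = x + y + s2 * wp t - beta * t
  + Rintegral lebesgue_measure `[0, t] (fun s => - q1 s).
Proof.
move=> t0; rewrite q1E// q2E// RintegralD//; first ring.
- exact: integrable_path.
- exact: integrable_path.
Qed.

Lemma sum_increment_le u v m : 0 <= u -> u <= v ->
  (forall r, u < r -> r <= v -> - q1 r <= m) ->
  q1 v + q2 v <= q1 u + q2 u + s2 * (wp v - wp u) - beta * (v - u) + m * (v - u).
Proof.
move=> u0 uv H; rewrite !sumE ?(le_trans u0)//.
have := Rintegral_increment_le contN1 u0 uv H; lra.
Qed.

Lemma sum_increment_ge u v : 0 <= u -> u <= v ->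
  q1 u + q2 u + s2 * (wp v - wp u) - beta * (v - u) <= q1 v + q2 v.
Proof.
move=> u0 uv; rewrite !sumE ?(le_trans u0)//.
have := @Rintegral_increment_ge _ _ u v 0 contN1 u0 uv.
have H r : u < r -> r <= v -> 0 <= - q1 r.
  by move=> ur _; rewrite oppr_ge0 q1_le0// (le_trans u0)// ltW.
move=> /(_ H); lra.
Qed.

Lemma q2_increment_le u v m : 0 <= u -> u <= v ->
  (forall r, u < r -> r <= v -> m <= q2 r) ->
  q2 v <= q2 u + (l v - l u) - m * (v - u).
Proof.
move=> u0 uv H; rewrite !q2E ?(le_trans u0)//.
have := Rintegral_increment_ge cont2 u0 uv H; lra.
Qed.

(** After the last time at which [q2] is nonnegative, the drift [- q2] is nonnegative and [l] does
    not decrease, so [q2] cannot fall below its value at that time. *)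
Lemma q2_ge0 t : 0 <= y -> 0 <= t -> 0 <= q2 t.
Proof.
move=> y0 t0; rewrite leNgt; apply/negP => q2t.
have cN2 : halfline_continuous (fun s => - q2 s).
  by apply: within_halfline_continuous => z; apply: cvgN; exact: cont2.
have [|u [u0 ut qu Hu]] := @last_time_le _ _ 0 t 0 cN2 (lexx 0) t0.
  by rewrite q2_start oppr_le0.
have H r : u < r -> r <= t -> q2 r <= 0.
  by move=> ur rt; rewrite -oppr_ge0 ltW// Hu.
have := Rintegral_increment_le cont2 u0 ut H.
have := l_nondecreasing u0 ut.
move: q2t qu; rewrite !q2E//; lra.
Qed.

(** By complementarity the set where [q1 < 0] has mass zero for the Stieltjes measure of [l]. It
    contains []u, v]], whose mass is [l v - l u]. *)
Lemma l_constant u v : 0 <= u -> u <= v ->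
  (forall r, u < r -> r <= v -> q1 r < 0) -> l v = l u.
Proof.
move=> u0 uv H.
have v0 := le_trans u0 uv.
have [F [Fl _ F0]] : exists F : cumulative R R,
     [/\ (forall t, 0 <= t -> F t = l t),
         (forall t, t < 0 -> F t = 0) &
         (\int[lebesgue_stieltjes_measure F]_(t in `[0%R, +oo[)
              (\1_[set s | q1 s < 0] t)%:E = 0)%E].
  by case: sol => _ [_ [_ [_ [_ [_ [_ [_ [_ [_ +]]]]]]]]].
pose A := `[0, +oo[%classic `&` [set s | q1 s < 0].
have mA : measurable A.
  have := subspace_continuous_measurable_fun (measurable_itv `[0, +oo[) cont1.
  move=> /(_ (measurable_itv _) `]-oo, 0[%classic (measurable_itv _)).
  by congr measurable; apply/seteqP; split => z /=; rewrite /A/= !in_itv/=.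
have : lebesgue_stieltjes_measure F (A `&` `[0, +oo[) = 0%E.
  rewrite -integral_indic// -[RHS]F0; apply: eq_integral => z.
  rewrite inE/= => zI; congr (_%:E); rewrite /indic; congr (_%:R).
  congr nat_of_bool.
  by apply/idP/idP; rewrite !inE /A/=; [case|split].
move=> FA0.
have : (lebesgue_stieltjes_measure F `]u, v] <= 0)%E.
  rewrite -FA0; apply: le_measure; rewrite ?inE//.
    exact: measurableI.
  move=> z /=; rewrite in_itv/= => /andP[uz zv]; rewrite /A/= !in_itv/=.
  by rewrite !andbT (le_trans u0 (ltW uz)); split=> //; split=> //; apply: H.
have -> : lebesgue_stieltjes_measure F `]u, v]%classic = (F v - F u)%:E.
  rewrite /lebesgue_stieltjes_measure /measure_extension/=.
  by rewrite measurable_mu_extE/= ?wlength_itv_bnd//; exact: is_ocitv.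
rewrite lee_fin !Fl//.
have := l_nondecreasing u0 uv => ? ?; apply/eqP; rewrite eq_le; lra.
Qed.

Lemma q1_increment_ge u v m : 0 <= u -> u <= v ->
  (forall r, u < r -> r <= v -> q1 r < 0) ->
  (forall r, u < r -> r <= v -> m <= - q1 r + q2 r) ->
  q1 u + s2 * (wp v - wp u) - beta * (v - u) + m * (v - u) <= q1 v.
Proof.
move=> u0 uv neg H; rewrite !q1E ?(le_trans u0)// (l_constant u0 uv neg).
have cont12 : {within `[0, +oo[, continuous (fun s => - q1 s + q2 s)}.
  by move=> z; apply: cvgD; [exact: contN1|exact: cont2].
have := Rintegral_increment_ge cont12 u0 uv H; lra.
Qed.

(* Beyond the last time [u] at which [- q1 <= a], the mean reversion compensates
   the linear part of the bound on the increments of the input. *)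
Lemma q1_lower_bound a v : 0 <= y -> 0 <= v -> 0 <= a -> - q1 0 <= a ->
  (forall u, 0 <= u -> u <= v ->
     - (s2 * (wp v - wp u)) + beta * (v - u) <= a * (1 + (v - u))) ->
  - q1 v <= 2 * a.
Proof.
move=> y0 v0 a0 q10 H.
have cN1 : halfline_continuous (fun s => - q1 s).
  exact: within_halfline_continuous.
have [u [u0 uv qu Hu]] := last_time_le cN1 (lexx 0) v0 q10.
have neg r : u < r -> r <= v -> q1 r < 0.
  by move=> ur rv; have := Hu r ur rv; lra.
have pull r : u < r -> r <= v -> a <= - q1 r + q2 r.
  move=> ur rv; have := Hu r ur rv.
  by have := q2_ge0 y0 (le_trans u0 (ltW ur)); lra.
have := q1_increment_ge u0 uv neg pull.
have := H u u0 uv; nra.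
Qed.

(* By the AM-GM inequality, this is a modulus [8 * sqrt ((v - u) * lam) + theta]. *)
Definition linear_modulus (lam theta a b : R) :=
  forall u v c, a <= u -> u <= v -> v <= b -> 0 < c ->
  `|wp v - wp u| <= c * (v - u) + 16 * lam / c + theta.

Let s2_le : s2 <= 3 / 2.
Proof.
have -> : 3 / 2 = Num.sqrt ((3 / 2) ^+ 2 : R) by rewrite sqrtr_sqr ger0_norm//; lra.
by rewrite ler_sqrt; nra.
Qed.

Lemma scaled_modulus lam theta a b u v c : 0 <= lam -> linear_modulus lam theta a b ->
  a <= u -> u <= v -> v <= b -> 0 < c ->
  s2 * `|wp v - wp u| <= c * (v - u) + 36 * lam / c + 3 / 2 * theta.
Proof.
move=> lam0 H au uv vb c0.
(* The slope is scaled by 2/3 so that the bound 3/2 for the square root of 2 restores [c]; the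
   coefficient 16 becomes 16 (3/2)^2 = 36. *)
have c'0 : 0 < 2 / 3 * c by lra.
have h := H u v _ au uv vb c'0.
have h' := ler_wpM2r (normr_ge0 (wp v - wp u)) s2_le.
apply: (le_trans h').
have : 16 * lam / (2 / 3 * c) = 24 * lam / c.
  by field; rewrite gt_eqF.
have -> : 36 * lam / c = 3 / 2 * (24 * lam / c) by field; rewrite gt_eqF.
move=> e; rewrite e in h; nra.
Qed.

(* Above this level of [q2], the excursions of [q1] stay above [- beta / 2]. *)
Definition busy_level (lam : R) := beta + 144 * lam / beta.

(** While [q2] is above [busy_level], each excursion of [q1] below 0 is pulled back fast enough to
    stay above [- beta / 2]. The sum then has drift at most [- beta / 2]; half of it pays for the
    linear part of the modulus and [- beta / 4] remains. *)
Lemma q2_drift lam theta v0 v1 : 0 < beta -> 0 < lam -> 3 / 2 * theta <= beta / 4 ->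
  0 <= v0 -> v0 <= v1 -> linear_modulus lam theta v0 v1 -> q1 v0 = 0 ->
  (forall r, v0 < r -> r <= v1 -> busy_level lam < q2 r) ->
  q2 v1 <= q2 v0 + 144 * lam / beta + beta - beta / 4 * (v1 - v0).
Proof.
move=> beta0 lam0 th v00 v01 mod q10 busy.
have small v : v0 <= v -> v <= v1 -> - q1 v <= beta / 2.
  move=> v0v vv1.
  have cN1 : halfline_continuous (fun s => - q1 s).
    exact: within_halfline_continuous.
  have [|r [r0 rv qr Hr]] := @last_time_le _ _ v0 v 0 cN1 v00 v0v.
    by rewrite q10 oppr0.
  have r00 := le_trans v00 r0.
  have neg z : r < z -> z <= v -> q1 z < 0.
    by move=> rz zv; rewrite -oppr_gt0 Hr.
  have pull z : r < z -> z <= v -> busy_level lam <= - q1 z + q2 z.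
    move=> rz zv; have := neg z rz zv.
    have := busy z (le_lt_trans r0 rz) (le_trans zv vv1); lra.
  have := q1_increment_ge r00 rv neg pull.
  (* With this slope, the linear part of the modulus is cancelled by the excess of [busy_level] over
     [beta], and the constant part 36 lam / c is only [beta / 4]. *)
  have D0 : 0 < 144 * lam / beta by rewrite divr_gt0//; lra.
  have := scaled_modulus (ltW lam0) mod r0 rv vv1 D0.
  have -> : 36 * lam / (144 * lam / beta) = beta / 4.
    by field; rewrite !gt_eqF.
  have : - (s2 * `|wp v - wp r|) <= s2 * (wp v - wp r).
    by rewrite -mulrN ler_wpM2l// lerNl -normrN ler_norm.
  rewrite /busy_level; lra.
have b4 : 0 < beta / 4 by lra.
have := sum_increment_le v00 v01 (fun r h1 h2 => small r (ltW h1) h2).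
have := scaled_modulus (ltW lam0) mod (lexx _) v01 (lexx _) b4.
have -> : 36 * lam / (beta / 4) = 144 * lam / beta by field; rewrite gt_eqF.
have : s2 * (wp v1 - wp v0) <= s2 * `|wp v1 - wp v0|.
  by rewrite ler_wpM2l// ler_norm.
have := small v1 v01 (lexx _); rewrite q10; lra.
Qed.

(** Follow [q2] from the last time [u] at which it is at most [busy_level]. There [q1 u = 0], so
    [q2_drift] applies from [u] on. *)
Lemma q2_upper_bound lam theta s v : 0 < beta -> 0 <= y -> 0 < lam -> 3 / 2 * theta <= beta / 4 ->
  0 <= s -> s <= v -> linear_modulus lam theta s v -> q2 s <= busy_level lam ->
  q2 v <= 288 * lam / beta + 2 * beta.
Proof.
move=> beta0 y0 lam0 th s0 sv mod q2s.
have [u [su uv qu Hu]] := last_time_le q2_continuous s0 sv q2s.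
have u0 := le_trans s0 su.
have D0 : 0 < 144 * lam / beta by rewrite divr_gt0//; lra.
have E : 288 * lam / beta = 2 * (144 * lam / beta) by ring.
move: uv; rewrite le_eqVlt => /predU1P[uv|uv].
  by move: qu; rewrite uv /busy_level E; lra.
(* If [q1 u < 0], then [l] is constant just after [u] and [q2] cannot rise above the level there. *)
have q1u : q1 u = 0.
  apply/eqP; rewrite eq_le q1_le0//= leNgt; apply/negP => q1u.
  have [|d d0 Hd] := q1_continuous u0 (e := - q1 u); first by lra.
  pose z := Num.min v (u + d / 2).
  have uz : u < z by rewrite /z lt_min uv; lra.
  have zv : z <= v by rewrite /z ge_min lexx.
  have zd : z <= u + d / 2 by rewrite /z ge_min lexx orbT.
  have neg r : u < r -> r <= z -> q1 r < 0.
    move=> ur rz; have : `|q1 r - q1 u| < - q1 u.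
      by apply: Hd; [lra|rewrite gtr0_norm; lra].
    by rewrite ltr_norml; lra.
  have lz := l_constant u0 (ltW uz) neg.
  have := @q2_increment_le u z 0 u0 (ltW uz).
  have H r : u < r -> r <= z -> 0 <= q2 r by move=> ur _; apply: q2_ge0 => //; lra.
  move=> /(_ H); rewrite lz; have := Hu z uz zv; lra.
have mod' : linear_modulus lam theta u v.
  by move=> a b c ua ab bv c0; apply: mod => //; exact: le_trans ua.
have := q2_drift beta0 lam0 th u0 (ltW uv) mod' q1u Hu.
have : 0 <= beta / 4 * (v - u) by rewrite mulr_ge0; lra.
by move: qu; rewrite /busy_level E; lra.
Qed.

(** If [q2] reaches [busy_level] before [v], [q2_upper_bound] concludes. Otherwise [q1] hits 0
    within a time [m / beta], and the drift [- beta / 4] over the remaining time, at least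
    [4 m / beta], uses up the initial [m]. *)
Lemma q2_relaxation lam theta s v m : 0 < beta -> 0 <= y -> 0 < lam -> 3 / 2 * theta <= beta / 4 ->
  0 <= s -> s <= v -> linear_modulus lam theta s v ->
  (forall r, s <= r -> r <= v -> q2 r <= m) -> 5 * m / beta <= v - s ->
  q2 v <= 288 * lam / beta + 2 * beta.
Proof.
move=> beta0 y0 lam0 th s0 sv mod q2m len.
have D0 : 0 < 144 * lam / beta by rewrite divr_gt0//; lra.
have E : 288 * lam / beta = 2 * (144 * lam / beta) by ring.
have m0 : 0 <= m by apply: le_trans (q2m s (lexx _) sv); exact: q2_ge0.
have [[r [sr rv q2r]]|nor] :=
    pselect (exists r, [/\ s <= r, r <= v & q2 r <= busy_level lam]).
  apply: (q2_upper_bound beta0 y0 lam0 th (le_trans s0 sr) rv _ q2r) => a b c ra ab bv c0.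
  by apply: mod => //; exact: le_trans ra.
have busy r : s <= r -> r <= v -> busy_level lam < q2 r.
  by move=> sr rv; rewrite ltNge; apply/negP => q2r; apply: nor; exists r.
have h0 : 0 <= m / beta by rewrite divr_ge0// ltW.
have len' : 5 * (m / beta) <= v - s by rewrite mulrA.
pose z := s + m / beta.
have sz : s <= z by rewrite /z; lra.
have zv : z <= v by rewrite /z; lra.
have mE : beta * (m / beta) = m by field; rewrite gt_eqF.
have [r [sr rz q1r]] : exists r, [/\ s < r, r <= z & q1 r = 0].
  apply: contrapT => noz.
  (* Without a zero of [q1] there is no inflow, and [q2], decreasing at rate at least [beta], would
     lose all of [m] by time [z]. *)
  have neg r : s < r -> r <= z -> q1 r < 0.
    move=> sr rz; rewrite lt_neqAle q1_le0 ?andbT; last lra.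
    by apply/eqP => q1r; apply: noz; exists r.
  have := @q2_increment_le s z beta s0 sz.
  have H r : s < r -> r <= z -> beta <= q2 r.
    move=> sr rz; have := busy r (ltW sr) (le_trans rz zv).
    by rewrite /busy_level; lra.
  move=> /(_ H); rewrite (l_constant s0 sz neg).
  have := busy z sz zv; have := q2m s (lexx _) sv; rewrite /busy_level /z; lra.
have mod' : linear_modulus lam theta r v.
  by move=> a b c ra ab bv c0; apply: mod => //; apply: le_trans ra; exact: ltW.
have r0 : 0 <= r by lra.
have rv : r <= v by lra.
have := q2_drift beta0 lam0 th r0 rv mod' q1r.
have H z' : r < z' -> z' <= v -> busy_level lam < q2 z'.
  by move=> rz' z'v; apply: busy => //; lra.
move=> /(_ H); have := q2m r (ltW sr) rv.
have : 4 * (m / beta) <= v - r by move: rz; rewrite /z; lra.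
by rewrite E; nra.
Qed.

End reflected_paths.

(** * Gaussian increments *)

Section gaussian_tails.
Context {R : realType}.
Implicit Types s a x p : R.

Lemma sqrt_two_pi_le3 : Num.sqrt (pi *+ 2 : R) <= 3.
Proof.
have -> : 3 = Num.sqrt (3 ^+ 2 : R) by rewrite sqrtr_sqr ger0_norm.
rewrite ler_sqrt ?exprn_gt0//.
have := @pihalf_lt2 R; rewrite ltr_pdivrMr// -mulr_natr => h; nra.
Qed.

Lemma measurable_abs_gt a : measurable [set z : R | a < `|z|].
Proof.
rewrite (_ : [set z : R | a < `|z|] = (fun z => `|z|) @^-1` `]a, +oo[%classic).
  rewrite -[X in measurable X]setTI; by apply: normr_measurable.
by apply/seteqP; split => z /=; rewrite in_itv/= andbT.
Qed.

(* The density is dominated by that of a Gaussian of twice the standard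
   deviation, up to the factor gained from a quarter of the exponent. *)
Lemma normal_prob_tail s a : 0 < s -> 0 <= a ->
  (normal_prob 0 s [set z | a < `|z|]%R <=
   (2 * expR (- (3 / 8 * a ^+ 2 / s ^+ 2)))%:E)%E.
Proof.
move=> s0 a0.
have mA := measurable_abs_gt a.
move: mA; set A := [set z | _] => mA.
have s0' : s != 0 by rewrite gt_eqF.
have ss0 : 2 * s != 0 by rewrite mulf_neq0.
set K := 2 * expR _.
have K0 : 0 <= K by rewrite mulr_ge0// expR_ge0.
have mpdf t : measurable_fun setT (fun z => (normal_pdf 0 t z)%:E : \bar R).
  by apply/measurable_EFinP; exact: measurable_normal_pdf.
rewrite /normal_prob.
apply: (@le_trans _ _ (\int[lebesgue_measure]_(z in A)
     (K%:E * (normal_pdf 0 (2 * s) z)%:E)))%E.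
  apply: ge0_le_integral => //.
  - by move=> z _; rewrite lee_fin normal_pdf_ge0.
  - exact: measurable_funTS (mpdf _).
  - by apply: measurable_funeM; exact: measurable_funTS (mpdf _).
  move=> z /= az; rewrite -EFinM lee_fin !normal_pdfE// /normal_peak /normal_fun !subr0.
  have -> : Num.sqrt ((2 * s) ^+ 2 * pi *+ 2 : R) = 2 * Num.sqrt (s ^+ 2 * pi *+ 2).
    have -> : (2 * s) ^+ 2 * pi *+ 2 = 2 ^+ 2 * (s ^+ 2 * pi *+ 2) :> R.
      by ring.
    by rewrite sqrtrM ?exprn_ge0// sqrtr_sqr ger0_norm.
  rewrite invfM; set peak := (Num.sqrt _)^-1.
  have peak0 : 0 <= peak by rewrite invr_ge0 sqrtr_ge0.
  rewrite /K.
  have -> : forall e f : R, 2 * e * (2^-1 * peak * f) = peak * (e * f).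
    by move=> e f; field.
  rewrite ler_wpM2l// -expRD ler_expR.
  have az2 : a ^+ 2 <= z ^+ 2.
    by rewrite -[z ^+ 2]real_normK ?num_real// lerXn2r// ?nnegrE//; exact: ltW.
  have -> : - z ^+ 2 / (s ^+ 2 *+ 2) = - (z ^+ 2 / s ^+ 2) / 2 by field.
  have -> : - z ^+ 2 / ((2 * s) ^+ 2 *+ 2) = - (z ^+ 2 / s ^+ 2) / 8.
    by field.
  have : a ^+ 2 / s ^+ 2 <= z ^+ 2 / s ^+ 2.
    by rewrite ler_wpM2r// invr_ge0 exprn_ge0// ltW.
  rewrite -mulrA; lra.
apply: (@le_trans _ _ (\int[lebesgue_measure]_z
     (K%:E * (normal_pdf 0 (2 * s) z)%:E)))%E.
  apply: ge0_subset_integral => //.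
  - exact: measurable_funeM (mpdf _).
  - by move=> z _; rewrite -EFinM lee_fin mulr_ge0// normal_pdf_ge0.
rewrite ge0_integralZl//.
- by rewrite integral_normal_pdf// mule1.
- exact: mpdf.
by move=> z _; rewrite lee_fin normal_pdf_ge0.
Qed.

(** On an interval of length [s] within [x + 1] standard deviations of 0, the density is at least
    its peak times exp (- (x + 1)^2 / 2). The length cancels the [s] in the peak, leaving the factor
    1 / sqrt (2 pi) >= 1/3. *)
Lemma normal_prob_lower s x p (A : set R) : 0 < s -> 0 <= x -> measurable A ->
  - (s * (x + 1)) <= p -> p + s <= s * (x + 1) -> `[p, p + s] `<=` A ->
  ((expR (- ((x + 1) ^+ 2 / 2)) / 3)%:E <= normal_prob 0 s A)%E.
Proof.
move=> s0 x0 mA p1 p2 sub.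
have s0' : s != 0 by rewrite gt_eqF.
have mpdf t : measurable_fun setT (fun z => (normal_pdf 0 t z)%:E : \bar R).
  by apply/measurable_EFinP; exact: measurable_normal_pdf.
apply: (@le_trans _ _ (normal_prob 0 s `[p, p + s])); last first.
  rewrite /normal_prob; apply: ge0_subset_integral => //.
  - exact: measurable_funTS (mpdf _).
  - by move=> z _; rewrite lee_fin normal_pdf_ge0.
set K := expR _.
have K0 : 0 <= K by exact: expR_ge0.
pose peak := normal_peak s.
have peakE : peak = (s * Num.sqrt (pi *+ 2))^-1.
  rewrite /peak /normal_peak -mulrnAr sqrtrM ?exprn_ge0 ?sqrtr_sqr ?gtr0_norm//.
  exact: ltW.
have peak0 : 0 <= peak by rewrite normal_peak_ge0.
apply: (@le_trans _ _ (\int[lebesgue_measure]_(z in `[p, (p + s)%R]) (cst (peak * K)%:E z)))%E.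
  rewrite integral_cst//=.
  have -> : lebesgue_measure `[p, (p + s)]%classic = s%:E.
    have := lebesgue_measure_itv `[p, (p + s)]; rewrite /= lte_fin ifT; last by lra.
    by rewrite -EFinB; have -> : p + s - p = s by [ring]; move=> <-.
  rewrite -EFinM lee_fin peakE invfM.
  have q0 : 0 < Num.sqrt (pi *+ 2 : R).
    by rewrite sqrtr_gt0 mulrn_wgt0// pi_gt0.
  have -> : s^-1 * (Num.sqrt (pi *+ 2))^-1 * K * s = K * (Num.sqrt (pi *+ 2))^-1.
    by field; rewrite s0' gt_eqF.
  by rewrite ler_wpM2l// lef_pV2 ?posrE// sqrt_two_pi_le3.
rewrite /normal_prob; apply: ge0_le_integral => //.
- by move=> z _; rewrite /= lee_fin mulr_ge0.
- exact: measurable_funTS (mpdf _).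
move=> z /=; rewrite in_itv/= => /andP[z1 z2]; rewrite lee_fin normal_pdfE//.
rewrite ler_wpM2l// /normal_fun ler_expR subr0 mulNr lerN2.
rewrite -mulr_natr invfM mulrA ler_wpM2r//.
rewrite ler_pdivrMr ?exprn_gt0// -exprMn [(x + 1) * s]mulrC.
rewrite -real_normK ?num_real// lerXn2r ?nnegrE//.
  by rewrite mulr_ge0//; lra.
by rewrite ler_norml; lra.
Qed.

End gaussian_tails.

(** * Laws and independence of Brownian increments *)

Section brownian_increments.
Context {R : realType} {d : measure_display} {T : measurableType d}.
Context (P : probability T R) (W : R -> T -> R) (BM : std_brownian_motion P W).
Implicit Types (u v a : R) (A B : set R).

Definition increment_in u v A := [set w | W v w - W u w \in A].

Lemma measurable_increment_in u v A : measurable A -> measurable (increment_in u v A).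
Proof.
case: BM => mW _ _ _ mA.
have := measurable_funB (mW v) (mW u) => /(_ measurableT A mA).
rewrite setTI; congr measurable; apply/seteqP.
by split => w /=; rewrite /increment_in /= inE.
Qed.

Lemma increment_prob u v A : 0 <= u -> u < v -> measurable A ->
  P (increment_in u v A) = normal_prob 0 (Num.sqrt (v - u)) A.
Proof.
move=> u0 uv mA.
have ht i : (i < 1)%N -> nth 0 [:: u; v] i < nth 0 [:: u; v] i.+1 by case: i.
case: BM => _ _ _ /(_ 1 (nth 0 [:: u; v]) (fun=> A) u0 ht (fun=> mA)).
rewrite big_ord1/= => <-; congr (P _); apply/seteqP; split.
- by move=> w Aw [|]//.
- by move=> w /(_ 0) /=; exact.
Qed.

(** Independence is given for consecutive increments over strictly increasing times. A gap between
    [v] and [u'] is filled by an unconstrained increment; adjacent intervals form a separate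
    case. *)
Lemma increment_prob2 u v u' v' A B : 0 <= u -> u < v -> v <= u' -> u' < v' ->
  measurable A -> measurable B ->
  P (increment_in u v A `&` increment_in u' v' B) =
  (P (increment_in u v A) * P (increment_in u' v' B))%E.
Proof.
move=> u0 uv vu' u'v' mA mB.
rewrite !increment_prob//; last by lra.
move: vu'; rewrite le_eqVlt => /predU1P[vu'|vu'].
  rewrite -vu' in u'v' *.
  have ht i : (i < 2)%N -> nth 0 [:: u; v; v'] i < nth 0 [:: u; v; v'] i.+1.
    by case: i => [|[|]].
  have mAB i : measurable (nth setT [:: A; B] i).
    by case: i => [|[|[|?]]]//=; exact: measurableT.
  case: BM => _ _ _ /(_ 2 (nth 0 [:: u; v; v']) _ u0 ht mAB).
  rewrite !big_ord_recr big_ord0/= mul1e => <-; congr (P _); apply/seteqP; split.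
  - by move=> w [Aw Bw] [|[|]]//.
  - by move=> w H; split; [exact: (H 0%N)|exact: (H 1%N)].
have ht i : (i < 3)%N -> nth 0 [:: u; v; u'; v'] i < nth 0 [:: u; v; u'; v'] i.+1.
  by case: i => [|[|[|]]].
have mAB i : measurable (nth setT [:: A; setT; B] i).
  by case: i => [|[|[|[|?]]]]//=; exact: measurableT.
case: BM => _ _ _ /(_ 3 (nth 0 [:: u; v; u'; v']) _ u0 ht mAB).
rewrite !big_ord_recr big_ord0/= mul1e.
have -> : normal_prob 0 (Num.sqrt (u' - v)) [set: R] = 1%E.
  by have := @probability_setT _ _ _ (normal_prob (R := R) 0 (Num.sqrt (u' - v))).
rewrite mule1 => <-; congr (P _); apply/seteqP; split.
- by move=> w [Aw Bw] [|[|[|]]]//= _; rewrite in_setT.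
- by move=> w H; split; [exact: (H 0%N)|exact: (H 2)].
Qed.

Definition jump u v a := [set w | a < `|W v w - W u w|].

Lemma jumpE u v a : jump u v a = increment_in u v [set z | a < `|z|].
Proof. by apply/seteqP; split => w /=; rewrite /increment_in/= inE. Qed.

Lemma measurable_jump u v a : measurable (jump u v a).
Proof. by rewrite jumpE; apply: measurable_increment_in; exact: measurable_abs_gt. Qed.

Lemma jump_prob u v a : 0 <= u -> u < v -> 0 <= a ->
  (P (jump u v a) <= (2 * expR (- (3 / 8 * a ^+ 2 / (v - u))))%:E)%E.
Proof.
move=> u0 uv a0; rewrite jumpE increment_prob//; last exact: measurable_abs_gt.
have s0 : 0 < Num.sqrt (v - u) by rewrite sqrtr_gt0 subr_gt0.
apply: (le_trans (normal_prob_tail s0 a0)).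
by rewrite sqr_sqrtr// subr_ge0 ltW.
Qed.

End brownian_increments.

(** * Chaining *)

Section chaining.
Context {R : realType}.
Implicit Types (f G : R -> R) (s u v delta lam : R).

Lemma grid_cell delta u : 0 < delta -> 0 <= u ->
  exists i : nat, i%:R * delta <= u < i.+1%:R * delta.
Proof.
move=> d0 u0; exists (Num.truncn (u / delta)).
have := truncn_itv (divr_ge0 u0 (ltW d0)).
by rewrite ler_pdivlMr// ltr_pdivrMr.
Qed.

(** Follow the left dyadic approximations of [v]. At level 0 this is [a] itself, so only levels m >=
    1 contribute, and k (3/4)^m sums to 3 k over them. *)
Lemma dyadic_chaining f (a delta k v : R) : halfline_continuous f ->
  0 <= a -> 0 < delta -> 0 <= k ->
  (forall m l, (l < 2 ^ m)%N ->
    `|f (a + l.+1%:R * (delta / 2 ^+ m)) - f (a + l%:R * (delta / 2 ^+ m))|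
    <= k * (3 / 4) ^+ m) ->
  a <= v -> v <= a + delta -> `|f v - f a| <= 3 * k.
Proof.
move=> cf a0 d0 k0 H av; rewrite le_eqVlt => /predU1P[->|vd].
  (* The right end lies in no half-open dyadic cell; the level 0 increment covers it. *)
  have := H 0%N 0%N isT; rewrite !expr0 mulr1 divr1 mul0r addr0 mul1r; lra.
have h0 m : 0 < delta / 2 ^+ m by rewrite divr_gt0// exprn_gt0.
have claim m : exists l, [/\ (l < 2 ^ m)%N,
    l%:R * (delta / 2 ^+ m) <= v - a,  v - a < l.+1%:R * (delta / 2 ^+ m) &
    `|f (a + l%:R * (delta / 2 ^+ m)) - f a| <= 3 * k * (1 - (3 / 4) ^+ m)].
  elim: m => [|m [l [lm lv vl fl]]].
    exists 0%N; rewrite expr0 mul0r addr0 subrr normr0 subrr mulr0 divr1 mul1r.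
    by split => //; lra.
  set h := delta / 2 ^+ m.+1.
  have hE : delta / 2 ^+ m = 2 * h by rewrite /h exprS; field; rewrite expf_neq0.
  have hp := h0 m.+1; rewrite -/h in hp.
  rewrite hE in lv vl fl.
  have e2l : l.*2%:R * h = l%:R * (2 * h) by rewrite -mul2n natrM; ring.
  have e2l1 : l.*2.+1%:R * h = l%:R * (2 * h) + h.
    by rewrite -natr1 mulrDl e2l mul1r.
  have q0 : 0 <= k * (3 / 4) ^+ m by rewrite mulr_ge0// exprn_ge0.
  have lm2 : (l.*2.+1 < 2 ^ m.+1)%N by rewrite expnS mul2n ltn_Sdouble.
  have [lt|ge] := ltP (v - a) (l.*2.+1%:R * h).
    exists l.*2; split => //.
    - exact: ltn_trans lm2.
    - by rewrite e2l.
    by rewrite e2l (le_trans fl)// exprS; lra.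
  exists l.*2.+1; split => //.
    rewrite -natr1 mulrDl e2l1 mul1r.
    by move: vl; rewrite -natr1 mulrDl mul1r; lra.
  have := H m.+1 l.*2 (ltn_trans (ltnSn _) lm2); rewrite -/h e2l1 e2l => H'.
  have := ler_normD (f (a + (l%:R * (2 * h) + h)) - f (a + l%:R * (2 * h)))
    (f (a + l%:R * (2 * h)) - f a).
  by rewrite subrKA; move: H' fl; rewrite exprS; lra.
(* Continuity at [v] makes the error of a fine enough dyadic approximation smaller than any [e]. *)
apply/ler_addgt0Pr => e e0.
have v0 := le_trans a0 av.
have [dd dd0 Hd] := cf v v0 e e0.
have [m hm] : exists m, delta / 2 ^+ m < dd.
  have := @cvg_geometric R delta 2^-1.
  have half1 : `|2^-1 : R| < 1 by rewrite ger0_norm; lra.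
  move=> /(_ half1) /cvgrPdist_lt /(_ dd dd0) [m _ /(_ m (leqnn m))].
  rewrite /geometric/= sub0r normrN exprVn ger0_norm; last first.
    by rewrite divr_ge0 ?(ltW d0)// exprn_ge0.
  by exists m.
have [l [lm lv vl fl]] := claim m.
have : `|f (a + l%:R * (delta / 2 ^+ m)) - f v| < e.
  apply: Hd; first by rewrite addr_ge0// mulr_ge0// ltW.
  rewrite ler0_norm; last lra.
  by move: vl; rewrite -natr1 mulrDl mul1r; lra.
have q0 : 0 <= k * (3 / 4) ^+ m by rewrite mulr_ge0// exprn_ge0.
have := ler_normB (f (a + l%:R * (delta / 2 ^+ m)) - f a)
  (f (a + l%:R * (delta / 2 ^+ m)) - f v).
have -> : f (a + l%:R * (delta / 2 ^+ m)) - f a - (f (a + l%:R * (delta / 2 ^+ m)) - f v)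
  = f v - f a by ring.
lra.
Qed.

(** Rounding [u] up and [v] down keeps the grid distance below [v - u], so that [G] applies by
    monotonicity. Rounding costs [k1] in each of the two cells, and [k2] for crossing the cell of
    [u]. *)
Lemma grid_modulus f G s delta (N : nat) (k1 k2 u v : R) :
  0 < delta -> 0 <= k1 -> 0 <= k2 ->
  {homo G : x y / x <= y} -> 0 <= G 0 ->
  (forall i j, (i < j <= N)%N ->
    `|f (s + j%:R * delta) - f (s + i%:R * delta)| <= G ((j - i)%:R * delta)) ->
  (forall i, (i < N)%N -> `|f (s + i.+1%:R * delta) - f (s + i%:R * delta)| <= k2) ->
  (forall i r, (i < N)%N -> s + i%:R * delta <= r -> r <= s + i.+1%:R * delta ->
    `|f r - f (s + i%:R * delta)| <= k1) ->
  s <= u -> u <= v -> v <= s + N%:R * delta ->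
  `|f v - f u| <= G (v - u) + (2 * k1 + k2).
Proof.
move=> d0 k10 k20 Ginc G0 pairs steps cells su uv vN.
have Gge x : 0 <= x -> 0 <= G x by move=> x0; apply: le_trans (Ginc _ _ x0).
have [i /andP[iu ui]] : exists i : nat, i%:R * delta <= u - s < i.+1%:R * delta.
  by apply: grid_cell => //; lra.
have [j /andP[jv vj]] : exists i : nat, i%:R * delta <= v - s < i.+1%:R * delta.
  by apply: grid_cell => //; lra.
have lti (a b : nat) : a%:R * delta < b%:R * delta -> (a < b)%N.
  by rewrite ltr_pM2r// ltr_nat.
have ij : (i <= j)%N by rewrite -ltnS; apply: lti; lra.
have jN : (j <= N)%N by rewrite -ltnS; apply: lti; rewrite -natr1 mulrDl mul1r; lra.
have cellj : `|f v - f (s + j%:R * delta)| <= k1.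
  move: jN; rewrite leq_eqVlt => /orP[/eqP jN|jN].
    have -> : v = s + j%:R * delta by apply/eqP; rewrite eq_le; rewrite jN; move: jv vN; rewrite jN; lra.
    by rewrite subrr normr0.
  by apply: cells => //; lra.
have [iN|iN] := ltnP i N; last first.
  have -> : v = u.
    have iN' : i = N by apply/eqP; rewrite eqn_leq iN (leq_trans ij jN).
    by apply/eqP; rewrite eq_le uv andbT; move: iu; rewrite iN'; lra.
  by rewrite subrr normr0 subrr; lra.
have celli : `|f u - f (s + i%:R * delta)| <= k1 by apply: cells => //; lra.
move: ij; rewrite leq_eqVlt => /orP[/eqP ij|ij].
  have := ler_normB (f v - f (s + j%:R * delta)) (f u - f (s + i%:R * delta)).
  rewrite ij (_ : _ - _ - _ = f v - f u); last by ring.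
  have : 0 <= G (v - u) by apply: Gge; lra.
  by move: cellj; rewrite -ij => cellj; lra.
have stepi := steps i iN.
have mid : `|f (s + j%:R * delta) - f (s + i.+1%:R * delta)| <= G (v - u).
  move: ij; rewrite leq_eqVlt => /orP[/eqP ->|ij].
    by rewrite subrr normr0; apply: Gge; lra.
  apply: (le_trans (pairs _ _ _)); first by rewrite ij.
  by apply: Ginc; rewrite natrB ?(ltnW ij)// mulrBl; lra.
have -> : f v - f u = (f v - f (s + j%:R * delta))
   + (f (s + j%:R * delta) - f (s + i.+1%:R * delta))
   + (f (s + i.+1%:R * delta) - f (s + i%:R * delta))
   - (f u - f (s + i%:R * delta)) by ring.
apply: (le_trans (ler_normB _ _)).
have := ler_normD ((f v - f (s + j%:R * delta)) + (f (s + j%:R * delta) - f (s + i.+1%:R * delta)))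
  (f (s + i.+1%:R * delta) - f (s + i%:R * delta)).
have := ler_normD (f v - f (s + j%:R * delta)) (f (s + j%:R * delta) - f (s + i.+1%:R * delta)).
lra.
Qed.

(** This is 2 p q <= p^2 + q^2 with p^2 = c r and q^2 = 16 lam / c. *)
Lemma sqrt_le_linear (r lam c : R) : 0 <= r -> 0 <= lam -> 0 < c ->
  8 * Num.sqrt (r * lam) <= c * r + 16 * lam / c.
Proof.
move=> r0 l0 c0.
have cr0 : 0 <= c * r by rewrite mulr_ge0// ltW.
have lc0 : 0 <= 16 * lam / c by rewrite divr_ge0 ?(ltW c0)//; lra.
pose p := Num.sqrt (c * r); pose q := Num.sqrt (16 * lam / c).
have pE : p ^+ 2 = c * r by rewrite sqr_sqrtr.
have qE : q ^+ 2 = 16 * lam / c by rewrite sqr_sqrtr.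
have -> : r * lam = (p * q / 4) ^+ 2.
  have -> : (p * q / 4) ^+ 2 = p ^+ 2 * q ^+ 2 / 16 by field.
  by rewrite pE qE; field; rewrite gt_eqF.
rewrite sqrtr_sqr ger0_norm; last by rewrite divr_ge0// mulr_ge0// sqrtr_ge0.
rewrite -pE -qE; have := sqr_ge0 (p - q); rewrite sqrrB; nra.
Qed.

End chaining.

(** * Union bounds and recurrence of events *)

Section geometric_series.
Context {R : realType}.

Lemma geometric_partial_sum_le (c r : R) n : 0 <= c -> 0 <= r -> r < 1 ->
  \sum_(0 <= i < n) c * r ^+ i <= c / (1 - r).
Proof.
move=> c0 r0 r1; have r1' : 0 < 1 - r by rewrite subr_gt0.
rewrite ler_pdivlMr//.
have -> : (\sum_(0 <= i < n) c * r ^+ i) * (1 - r) = c * (1 - r ^+ n).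
  elim: n => [|n IH]; first by rewrite big_geq// mul0r expr0 subrr mulr0.
  by rewrite big_nat_recr//= mulrDl IH exprS; ring.
by rewrite ler_piMr// lerBlDr lerDl exprn_ge0.
Qed.

Lemma nneseries_geometric_le (u : nat -> \bar R) (c r : R) :
  0 <= c -> 0 <= r -> r < 1 -> (forall i, 0 <= u i)%E ->
  (forall i, u i <= (c * r ^+ i)%:E)%E ->
  (\sum_(0 <= i <oo) u i <= (c / (1 - r))%:E)%E.
Proof.
move=> c0 r0 r1 u0 uc; apply: lime_le; first exact: is_cvg_nneseries.
apply: nearW => n; apply: (@le_trans _ _ (\sum_(0 <= i < n) (c * r ^+ i)%:E)%E).
  exact: lee_sum.
by rewrite sumEFin lee_fin geometric_partial_sum_le.
Qed.

End geometric_series.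

Section conditional_union_bound.
Context {R : realType} {d : measure_display} {T : measurableType d}.
Context (P : probability T R).
Implicit Types (A B D : set T) (F : nat -> set T) (c : R).

(** A bound [c] on the conditional probability of [A] given [D], written without division so that
    [D] may be null. *)
Definition rel_bounded D A c := measurable A /\ (P (A `&` D) <= c%:E * P D)%E.

Lemma rel_bounded_le D A c c' : c <= c' -> rel_bounded D A c -> rel_bounded D A c'.
Proof.
move=> cc [mA PA]; split=> //; apply: (le_trans PA).
by apply: lee_wpmul2r; rewrite ?lee_fin.
Qed.

Lemma rel_bounded_set0 D c : 0 <= c -> rel_bounded D set0 c.
Proof. by move=> c0; split=> //; rewrite set0I measure0 mule_ge0// lee_fin. Qed.

Lemma rel_bounded_setU D A B c c' : measurable D -> rel_bounded D A c ->
  rel_bounded D B c' -> rel_bounded D (A `|` B) (c + c').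
Proof.
move=> mD [mA PA] [mB PB]; split; first exact: measurableU.
rewrite setIUl (le_trans (measureU2 _ _ _))//; try exact: measurableI.
have PD : P D \is a fin_num by rewrite fin_num_measure.
by rewrite -(fineK PD) -EFinM mulrDl EFinD !EFinM fineK// leeD.
Qed.

Lemma rel_bounded_ord D F n c : measurable D -> 0 <= c ->
  (forall i, (i < n)%N -> rel_bounded D (F i) c) ->
  rel_bounded D (\bigcup_(i < n) F i) (n%:R * c).
Proof.
move=> mD c0; rewrite bigcup_mkord; elim: n => [|n IH] H.
  by rewrite big_ord0; apply: rel_bounded_set0; rewrite mul0r.
rewrite big_ord_recr/= -natr1 mulrDl mul1r; apply: rel_bounded_setU => //.
  by apply: IH => i ilt; apply: H; exact: ltn_trans ilt _.
exact: H.
Qed.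

Lemma rel_bounded_bigcup D F c : measurable D -> 0 <= c ->
  (forall m, rel_bounded D (F m) (c / 2 ^+ m)) ->
  rel_bounded D (\bigcup_m F m) (2 * c).
Proof.
move=> mD c0 H.
have mF m : measurable (F m) by case: (H m).
have PD : P D \is a fin_num by rewrite fin_num_measure.
have mU : measurable (\bigcup_m F m) by exact: bigcupT_measurable.
split=> //; rewrite setI_bigcupl.
apply: (le_trans (generalized_Boole_inequality _ _ _)).
- by move=> i; exact: measurableI.
- by apply: bigcupT_measurable => i; exact: measurableI.
have p0 : 0 <= fine (P D) by rewrite fine_ge0.
have -> : ((2 * c)%:E * P D = (c * fine (P D) / (1 - 2^-1))%:E)%E.
  by rewrite -[in LHS](fineK PD) -EFinM; congr (_%:E); field.
apply: nneseries_geometric_le; rewrite ?mulr_ge0//; first by lra.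
move=> i; have [_ /le_trans] := H i; apply.
by rewrite -[in leLHS](fineK PD) -EFinM lee_fin exprVn le_eqVlt; apply/orP; left; apply/eqP; ring.
Qed.

End conditional_union_bound.

(** * Borel-Cantelli and second moment arguments *)

Section borel_cantelli.
Context {R : realType} {d : measure_display} {T : measurableType d}.
Context (P : probability T R).

Lemma ae_eventually_not (F : nat -> set T) (c r : R) : 0 <= c -> 0 <= r -> r < 1 ->
  (forall n, measurable (F n)) -> (forall n, (P (F n) <= (c * r ^+ n)%:E)%E) ->
  {ae P, forall w, exists N, forall n, (N <= n)%N -> ~ F n w}.
Proof.
move=> c0 r0 r1 mF PF.
have /(lim_sup_set_cvg0 mF) L0 : (\sum_(0 <= i <oo) P (F i) < +oo)%E.
  by apply: le_lt_trans (nneseries_geometric_le c0 r0 r1 _ PF) _; rewrite ?ltry.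
exists (lim_sup_set F); split => //.
  apply: bigcap_measurable => // n _; apply: bigcup_measurable => //.
move=> w /= Hw n _; apply: contrapT => nF; apply: Hw; exists n => k nk Fk.
by apply: nF; exists k.
Qed.

Lemma ae_infinitely_often (G : nat -> set T) : (forall n, measurable (G n)) ->
  (forall e : R, 0 < e -> exists N, forall n, (N <= n)%N -> (P (~` G n) <= e%:E)%E) ->
  {ae P, forall w, forall N, exists2 n, (N <= n)%N & G n w}.
Proof.
move=> mG small; apply: ae_foralln => N.
pose A := \bigcap_(n in [set n | (N <= n)%N]) ~` G n.
have mA : measurable A by apply: bigcap_measurableType => n _; exact: measurableC.
exists A; split => //; last first.
  by move=> w /= Hw n /= Nn Gn; apply: Hw; exists n.
apply/eqP; rewrite eq_le measure_ge0 andbT; apply/lee_addgt0Pr => e e0.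
have [M HM] := small e e0.
rewrite add0e; apply: le_trans (HM (maxn N M) (leq_maxr _ _)).
apply: le_measure; rewrite ?inE//; first exact: measurableC.
by move=> w; apply; exact: leq_maxl.
Qed.

(* Chebyshev's inequality for the number [X] of the [D i] that occur and Markov's
   for the number [Y] of those spoiled by [F i]: if no [D i] occurs unspoiled then
   [X = Y], so either [X <= mu / 2] or [Y >= mu / 2], where [mu = m p]. *)
Lemma second_moment (m : nat) (D F : nat -> set T) (p e : R) : (0 < m)%N -> 0 < p ->
  (forall i, measurable (D i)) -> (forall i, measurable (F i)) ->
  (forall i, P (D i) = p%:E) ->
  (forall i j, (i < j)%N -> P (D i `&` D j) = (p * p)%:E) ->
  (forall i, (P (F i `&` D i) <= (e * p)%:E)%E) ->
  (P (~` \bigcup_(i < m) (D i `\` F i)) <= (4 / (m%:R * p) + 2 * e)%:E)%E.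
Proof.
move=> m0 p0 mD mF PD PDD PFD.
set E := ~` _.
have mE : measurable E.
  by apply: measurableC; apply: bigcup_measurable => i _; exact: measurableD.
pose mu := m%:R * p.
have mu0 : 0 < mu by rewrite mulr_gt0// ltr0n.
pose ind (A : set T) (w : T) : R := \1_A w.
have ind0 A w : 0 <= ind A w by rewrite /ind indicE.
have mind A : measurable A -> measurable_fun setT (EFin \o ind A : T -> \bar R).
  by move=> mA; apply/measurable_EFinP; exact: measurable_indic.
have intind A : measurable A -> (\int[P]_w (ind A w)%:E = P A)%E.
  by move=> mA; rewrite integral_indic// setIT.
pose X w := \sum_(i < m) ind (D i) w.
pose Y w := \sum_(i < m) ind (F i `&` D i) w.
pose Z w := \sum_(i < m) \sum_(j < m) ind (D i `&` D j) w.
have XX w : X w * X w = Z w.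
  rewrite /X mulr_suml; apply: eq_bigr => i _; rewrite mulr_sumr.
  by apply: eq_bigr => j _; rewrite /ind indicI.
(* With q = X / mu this reads 1_E <= 4 (q - 1)^2 + 2 Y / mu: on [E] one has Y = X, and either q <=
   1/2 or 2 Y / mu > 1. The negative term is moved to the left so that both sides are nonnegative
   and can be integrated. *)
have key w : ind E w + 8 / mu * X w <= 4 / mu ^+ 2 * Z w + (4 + 2 / mu * Y w).
  have Y0 : 0 <= Y w by apply: sumr_ge0.
  rewrite -XX.
  pose q := X w / mu.
  have -> : 8 / mu * X w = 8 * q by rewrite /q; ring.
  have -> : 4 / mu ^+ 2 * (X w * X w) = 4 * q ^+ 2.
    by rewrite /q; field; rewrite gt_eqF.
  have -> : 2 / mu * Y w = 2 * (Y w / mu) by ring.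
  have Yq0 : 0 <= Y w / mu by rewrite divr_ge0// ltW.
  rewrite /ind indicE; have [/set_mem Ew|_] := boolP (w \in E); last first.
    by have := sqr_ge0 (q - 1); rewrite sqrrB1 /=; nra.
  have -> : Y w = X w.
    apply: eq_bigr => i _; rewrite /ind indicI/= !indicE.
    have [/set_mem Dw|] := boolP (w \in D i); last by rewrite mulr0.
    suff -> : w \in F i by rewrite mulr1.
    by apply/mem_set; apply: contrapT => nF; apply: Ew; exists i => //=.
  rewrite -/q; have [q2|q2] := leP q (1 / 2).
    have q0 : 0 <= q by rewrite divr_ge0 ?(ltW mu0)//; apply: sumr_ge0.
    by rewrite /=; nra.
  by have := sqr_ge0 (q - 1); rewrite sqrrB1; rewrite /=; nra.
have mX : measurable_fun setT (EFin \o X : T -> \bar R).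
  apply/measurable_EFinP; apply: measurable_sum => i; exact: measurable_indic.
have mY : measurable_fun setT (EFin \o Y : T -> \bar R).
  apply/measurable_EFinP; apply: measurable_sum => i; apply: measurable_indic.
  exact: measurableI.
have mZ : measurable_fun setT (EFin \o Z : T -> \bar R).
  apply/measurable_EFinP; apply: measurable_sum => i; apply: measurable_sum => j.
  by apply: measurable_indic; exact: measurableI.
have intX : (\int[P]_w (X w)%:E = mu%:E)%E.
  under eq_integral do rewrite -sumEFin.
  rewrite ge0_integral_sum//=.
  - rewrite (eq_bigr (fun=> p%:E)) => [|i _]; last by rewrite intind.
    by rewrite sumEFin sumr_const card_ord /mu mulr_natl.
  - by move=> i; exact: mind.
  - by move=> i w _; rewrite lee_fin.
have intY : (\int[P]_w (Y w)%:E <= (e * mu)%:E)%E.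
  under eq_integral do rewrite -sumEFin.
  rewrite ge0_integral_sum//=.
  - apply: (@le_trans _ _ (\sum_(i < m) (e * p)%:E)%E).
      apply: lee_sum => i _; rewrite intind//; exact: measurableI.
    by rewrite sumEFin lee_fin sumr_const card_ord /mu -mulr_natl; lra.
  - by move=> i; apply: mind; exact: measurableI.
  - by move=> i w _; rewrite lee_fin.
have intZ : (\int[P]_w (Z w)%:E <= (mu + mu ^+ 2)%:E)%E.
  under eq_integral do rewrite -sumEFin.
  have mDD i : measurable_fun setT (fun w => (\sum_(j < m) ind (D i `&` D j) w)%:E : \bar R).
    apply/measurable_EFinP; apply: measurable_sum => j.
    by apply: measurable_indic; exact: measurableI.
  rewrite ge0_integral_sum//=; last first.
    by move=> i w _; rewrite lee_fin; apply: sumr_ge0.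
  apply: (@le_trans _ _ (\sum_(i < m) (p + m%:R * (p * p))%:E)%E); last first.
    by rewrite sumEFin lee_fin sumr_const card_ord /mu -[_ *+ _]mulr_natl; nra.
  apply: lee_sum => i _.
  under eq_integral do rewrite -sumEFin.
  rewrite ge0_integral_sum//=; last first.
  - by move=> j w _; rewrite lee_fin.
  - by move=> j; apply: mind; exact: measurableI.
  (* Off-diagonal terms equal [p * p] by pairwise independence; the diagonal one contributes [p]. *)
  apply: (@le_trans _ _ (\sum_(j < m) (p * p + (j == i)%:R * p)%:E)%E).
    apply: lee_sum => j _; rewrite intind; last exact: measurableI.
    have [->|ji] := eqVneq j i.
      by rewrite setIid PD lee_fin mul1r lerDr mulr_ge0// ltW.
    rewrite mul0r addr0; have [ltij|ltji|eqij] := ltngtP i j.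
    - by rewrite PDD.
    - by rewrite setIC PDD.
    - by case/eqP: ji; exact/val_inj/esym.
  rewrite sumEFin lee_fin big_split/= sumr_const card_ord.
  rewrite (bigD1 i)//= eqxx big1 => [|j /negbTE ->]; last by rewrite mul0r.
  by rewrite mul1r -[_ *+ _]mulr_natl; lra.
have c8 : 0 <= 8 / mu by rewrite divr_ge0// ltW.
have c4 : 0 <= 4 / mu ^+ 2 by rewrite divr_ge0// exprn_ge0// ltW.
have c2 : 0 <= 2 / mu by rewrite divr_ge0// ltW.
have X0 w : 0 <= X w by apply: sumr_ge0.
have Y0 w : 0 <= Y w by apply: sumr_ge0.
have Z0 w : 0 <= Z w by apply: sumr_ge0 => i _; apply: sumr_ge0.
have eX : (\int[P]_w ((8 / mu)%:E * (X w)%:E) = (8 / mu)%:E * \int[P]_w (X w)%:E)%E.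
  by rewrite ge0_integralZl// => w _; rewrite lee_fin.
have eY : (\int[P]_w ((2 / mu)%:E * (Y w)%:E) = (2 / mu)%:E * \int[P]_w (Y w)%:E)%E.
  by rewrite ge0_integralZl// => w _; rewrite lee_fin.
have eZ : (\int[P]_w ((4 / mu ^+ 2)%:E * (Z w)%:E) =
           (4 / mu ^+ 2)%:E * \int[P]_w (Z w)%:E)%E.
  by rewrite ge0_integralZl// => w _; rewrite lee_fin.
have mcX : measurable_fun setT (fun w => (8 / mu)%:E * (X w)%:E : \bar R)%E.
  exact: measurable_funeM.
have mcY : measurable_fun setT (fun w => (2 / mu)%:E * (Y w)%:E : \bar R)%E.
  exact: measurable_funeM.
have mcZ : measurable_fun setT (fun w => (4 / mu ^+ 2)%:E * (Z w)%:E : \bar R)%E.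
  exact: measurable_funeM.
have m4Y : measurable_fun setT (fun w => 4%:E + (2 / mu)%:E * (Y w)%:E : \bar R)%E.
  by apply: emeasurable_funD.
have := @ge0_le_integral _ _ _ P setT measurableT
  (fun w => (ind E w)%:E + (8 / mu)%:E * (X w)%:E)%E
  (fun w => (4 / mu ^+ 2)%:E * (Z w)%:E + (4%:E + (2 / mu)%:E * (Y w)%:E))%E.
have H1 w : [set: T] w -> (0 <= (ind E w)%:E + (8 / mu)%:E * (X w)%:E)%E.
  by move=> _; rewrite -EFinM -EFinD lee_fin addr_ge0// mulr_ge0.
have H2 : measurable_fun setT (fun w => (ind E w)%:E + (8 / mu)%:E * (X w)%:E : \bar R)%E.
  by apply: emeasurable_funD => //; exact: mind.
have H3 : measurable_fun setT (fun w => (4 / mu ^+ 2)%:E * (Z w)%:E + (4%:E + (2 / mu)%:E * (Y w)%:E) : \bar R)%E.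
  exact: emeasurable_funD.
have H4 w : [set: T] w -> ((ind E w)%:E + (8 / mu)%:E * (X w)%:E <=
   (4 / mu ^+ 2)%:E * (Z w)%:E + (4%:E + (2 / mu)%:E * (Y w)%:E))%E.
  by move=> _; rewrite -!EFinM -!EFinD lee_fin key.
move=> /(_ H1 H2 H3 H4).
rewrite ge0_integralD//; last 3 first.
- by move=> w _; rewrite lee_fin.
- exact: mind.
- by move=> w _; rewrite -EFinM lee_fin mulr_ge0.
rewrite ge0_integralD//; last 2 first.
- by move=> w _; rewrite -EFinM lee_fin mulr_ge0.
- by move=> w _; rewrite -EFinM -EFinD lee_fin addr_ge0// mulr_ge0.
rewrite ge0_integralD//; last by move=> w _; rewrite -EFinM lee_fin mulr_ge0.
rewrite intind// eZ eX eY intX integral_cst//= probability_setT mule1.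
have PE : P E \is a fin_num by rewrite fin_num_measure.
have PY : (\int[P]_w (Y w)%:E)%E \is a fin_num.
  rewrite ge0_fin_numE; first exact: le_lt_trans intY (ltry _).
  by apply: integral_ge0 => w _; rewrite lee_fin.
have PZ : (\int[P]_w (Z w)%:E)%E \is a fin_num.
  rewrite ge0_fin_numE; first exact: le_lt_trans intZ (ltry _).
  by apply: integral_ge0 => w _; rewrite lee_fin.
rewrite -(fineK PE) -(fineK PY) -(fineK PZ) in intY intZ *.
rewrite -!EFinM -!EFinD !lee_fin in intY intZ *.
move: intY intZ; set iy := fine _; set iz := fine _; set pe := fine _ => intY intZ.
have -> : 8 / mu * mu = 8 by field; rewrite gt_eqF.
have : 4 / mu ^+ 2 * iz <= 4 / mu ^+ 2 * (mu + mu ^+ 2) by rewrite ler_wpM2l.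
have -> : 4 / mu ^+ 2 * (mu + mu ^+ 2) = 4 / mu + 4 by field; rewrite gt_eqF.
have : 2 / mu * iy <= 2 / mu * (e * mu) by rewrite ler_wpM2l.
have -> : 2 / mu * (e * mu) = 2 * e by field; rewrite gt_eqF.
rewrite -/mu; lra.
Qed.

End borel_cantelli.

(** * Modulus of continuity of Brownian motion on a grid *)

Section brownian_modulus.
Context {R : realType} {d : measure_display} {T : measurableType d}.
Context (P : probability T R) (W : R -> T -> R) (BM : std_brownian_motion P W).
Implicit Types (s u v a k delta lam : R) (D : set T).

(** Failure of the hypothesis of [dyadic_chaining] on the cell from [a] to [a + delta]. *)
Definition cell_bad a delta k := \bigcup_m \bigcup_(l < 2 ^ m)
  jump W (a + l%:R * (delta / 2 ^+ m)) (a + l.+1%:R * (delta / 2 ^+ m))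
    (k * (3 / 4) ^+ m).

(** The index [j] stands for the grid time of rank j + 1, so the two times always differ. A
    deviation 8 sqrt (r lam) over a time r costs (3/8) 64 lam = 24 lam in the exponent, whatever
    r. *)
Definition pair_bad s delta (N : nat) lam := \bigcup_(i < N) \bigcup_(j < N)
  if (i <= j)%N then
    jump W (s + i%:R * delta) (s + j.+1%:R * delta)
      (8 * Num.sqrt ((j.+1 - i)%:R * delta * lam))
  else set0.

Definition grid_bad s delta (N : nat) lam := pair_bad s delta N lam `|`
  \bigcup_(i < N) cell_bad (s + i%:R * delta) delta (8 * Num.sqrt (delta * lam)).

Lemma brownian_path_continuous w : halfline_continuous (W ^~ w).
Proof. by apply: within_halfline_continuous; case: BM => _ _ + _; apply. Qed.

(** Used with [D] either the whole space or an event on an increment after [b]: the same union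
    bounds then hold unconditionally and given a later rare event. *)
Definition jump_independent D (b : R) := forall u v a, 0 <= u -> u < v -> v <= b ->
  (P (jump W u v a `&` D) <= P (jump W u v a) * P D)%E.

Lemma jump_independent_setT b : jump_independent setT b.
Proof. by move=> u v a _ _ _; rewrite setIT probability_setT mule1. Qed.

Lemma jump_independent_increment b u v (A : set R) : b <= u -> u < v ->
  measurable A -> jump_independent (increment_in W u v A) b.
Proof.
move=> bu uv mA u' v' a u'0 u'v' v'b; rewrite jumpE (increment_prob2 BM)//.
  exact: le_trans bu.
exact: measurable_abs_gt.
Qed.

Lemma jump_rel_bounded D b u v a c : measurable D -> jump_independent D b ->
  0 <= u -> u < v -> v <= b -> 0 <= a ->
  2 * expR (- (3 / 8 * a ^+ 2 / (v - u))) <= c -> rel_bounded P D (jump W u v a) c.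
Proof.
move=> mD indep u0 uv vb a0 bc; apply: (rel_bounded_le bc); split.
  exact: measurable_jump BM _ _ _.
apply: (le_trans (indep _ _ _ u0 uv vb)).
by apply: lee_wpmul2r => //; exact: jump_prob.
Qed.

(** Level m has 2^m increments, each exceeding its bound with probability at most 2 exp (- 24 lam
    (9/8)^m). Since (9/8)^m >= 1 + m / 8 and lam >= 1, this is at most 2 exp (- 24 lam) 4^-m, and
    the sum over levels is geometric. *)
Lemma cell_bad_bounded D b a delta lam : measurable D -> jump_independent D b ->
  0 <= a -> 0 < delta -> a + delta <= b -> 1 <= lam ->
  rel_bounded P D (cell_bad a delta (8 * Num.sqrt (delta * lam)))
    (2 * (2 * expR (- (24 * lam)))).
Proof.
move=> mD indep a0 d0 adb lam1; apply: rel_bounded_bigcup => //.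
move=> m.
have h0 : 0 < delta / 2 ^+ m by rewrite divr_gt0// exprn_gt0.
have e0 : 0 <= expR (- (24 * lam)) by exact: expR_ge0.
have q0 : 0 < (4^-1 : R) ^+ m by rewrite exprn_gt0.
apply: (@rel_bounded_le _ _ _ _ _ _
    ((2 ^ m)%:R * (2 * expR (- (24 * lam)) * 4^-1 ^+ m))).
  rewrite natrX.
  have -> : 2 ^+ m * (2 * expR (- (24 * lam)) * 4^-1 ^+ m) =
            2 * expR (- (24 * lam)) * (2 ^+ m * 4^-1 ^+ m) :> R by ring.
  rewrite -exprMn (_ : 2 / 4 = 2^-1 :> R); last by field.
  by rewrite exprVn.
apply: rel_bounded_ord => //.
move=> l lm; apply: (jump_rel_bounded mD indep).
- by rewrite addr_ge0// mulr_ge0// ltW.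
- by rewrite ltrD2l ltr_pM2r// ltr_nat.
- apply: le_trans adb; rewrite lerD2l mulrCA ger_pMr//.
  by rewrite ler_pdivrMr ?exprn_gt0// mul1r -natrX ler_nat.
- by rewrite mulr_ge0// ?exprn_ge0// mulr_ge0.
rewrite -[leRHS]mulrA ler_pM2l//.
have -> : a + l.+1%:R * (delta / 2 ^+ m) - (a + l%:R * (delta / 2 ^+ m)) = delta / 2 ^+ m.
  by rewrite -natr1; ring.
have dl0 : 0 <= delta * lam by rewrite mulr_ge0 ?(ltW d0)//; lra.
have -> : (8 * Num.sqrt (delta * lam) * (3 / 4) ^+ m) ^+ 2 =
    8 ^+ 2 * (delta * lam) * ((3 / 4) ^+ 2) ^+ m.
  by rewrite exprMn [in LHS]exprMn sqr_sqrtr// -!exprM [(m * 2)%N]mulnC.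
have -> : 3 / 8 * (8 ^+ 2 * (delta * lam) * ((3 / 4) ^+ 2) ^+ m) / (delta / 2 ^+ m)
   = 24 * lam * (((3 / 4) ^+ 2) ^+ m * 2 ^+ m).
  move: (((3 / 4) ^+ 2) ^+ m) => q.
  by field; rewrite (gt_eqF d0) andbT expf_neq0.
rewrite -exprMn (_ : (3 / 4) ^+ 2 * 2 = 1 + 8^-1 :> R); last by field.
have bern : 1 + m%:R / 8 <= (1 + 8^-1 : R) ^+ m.
  elim: m {h0 q0 lm} => [|m IH]; first by rewrite mul0r addr0.
  rewrite exprS -natr1; have : 0 <= m%:R / 8 :> R by rewrite divr_ge0.
  by nra.
apply: (@le_trans _ _ (expR (- (24 * lam)) * expR (- 3) ^+ m)).
  rewrite -expRM_natl -expRD ler_expR.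
  have m0 : 0 <= m%:R / 8 :> R by rewrite divr_ge0.
  have -> : m%:R * -3 = - (24 * (m%:R / 8)) :> R by field.
  by nra.
rewrite ler_wpM2l// lerXn2r ?nnegrE ?expR_ge0 ?invr_ge0//.
rewrite expRN lef_pV2 ?posrE ?expR_gt0//.
by apply: le_trans (expR_ge1Dx _); lra.
Qed.

Lemma grid_bad_bounded D s delta (N : nat) lam : measurable D ->
  jump_independent D (s + N%:R * delta) -> 0 <= s -> 0 < delta -> 1 <= lam ->
  rel_bounded P D (grid_bad s delta N lam) (6 * N%:R ^+ 2 * expR (- (24 * lam))).
Proof.
move=> mD indep s0 d0 lam1.
have e0 : 0 <= expR (- (24 * lam)) by exact: expR_ge0.
apply: (@rel_bounded_le _ _ _ _ _ _
    (N%:R * (N%:R * (2 * expR (- (24 * lam)))) +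
     N%:R * (2 * (2 * expR (- (24 * lam)))))).
  have N2 : N%:R <= N%:R ^+ 2 :> R.
    by rewrite -natrX ler_nat -mulnn; case: N {indep} => // n; rewrite leq_pmull.
  by nra.
apply: rel_bounded_setU => //.
  apply: rel_bounded_ord => //.
  move=> i iN; apply: rel_bounded_ord => //.
  move=> j jN; case: ifP => ij; last by apply: rel_bounded_set0; rewrite mulr_ge0.
  have ij' : (i < j.+1)%N by [].
  have dl0 : 0 <= delta * lam by rewrite mulr_ge0 ?(ltW d0)//; lra.
  apply: (jump_rel_bounded mD indep).
  - by rewrite addr_ge0// mulr_ge0// ltW.
  - by rewrite ltrD2l ltr_pM2r// ltr_nat.
  - by rewrite lerD2l ler_pM2r// ler_nat.
  - by rewrite mulr_ge0.
  rewrite ler_pM2l// ler_expR lerN2 exprMn sqr_sqrtr; last first.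
    by rewrite -mulrA mulr_ge0.
  have -> : s + j.+1%:R * delta - (s + i%:R * delta) = (j.+1 - i)%:R * delta.
    by rewrite natrB ?(ltnW ij')//; ring.
  have ji0 : (j.+1 - i)%:R != 0 :> R by rewrite pnatr_eq0 subn_eq0 -ltnNge.
  rewrite le_eqVlt; apply/orP; left; apply/eqP; field.
  by rewrite ji0 gt_eqF.
apply: rel_bounded_ord => //.
move=> i iN; apply: (cell_bad_bounded mD indep) => //.
  by rewrite addr_ge0// mulr_ge0// ltW.
rewrite -addrA -{2}[delta]mul1r -mulrDl natr1 lerD2l ler_pM2r//.
by rewrite ler_nat.
Qed.

Lemma grid_good_modulus s delta (N : nat) lam w (G : R -> R) u v :
  0 <= s -> 0 < delta -> 0 <= lam -> ~ grid_bad s delta N lam w ->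
  {homo G : x y / x <= y} -> 0 <= G 0 ->
  (forall i j, (i < j <= N)%N ->
     `|W (s + j%:R * delta) w - W (s + i%:R * delta) w| <= G ((j - i)%:R * delta)) ->
  s <= u -> u <= v -> v <= s + N%:R * delta ->
  `|W v w - W u w| <= G (v - u) + 56 * Num.sqrt (delta * lam).
Proof.
move=> s0 d0 lam0 good Ginc G0 pairs su uv vN.
set k := 8 * Num.sqrt (delta * lam).
have k0 : 0 <= k by rewrite mulr_ge0.
have nocell i : (i < N)%N -> ~ cell_bad (s + i%:R * delta) delta k w.
  by move=> iN bad; apply: good; right; exists i.
have steps i m l : (i < N)%N -> (l < 2 ^ m)%N ->
  `|W (s + i%:R * delta + l.+1%:R * (delta / 2 ^+ m)) w -
    W (s + i%:R * delta + l%:R * (delta / 2 ^+ m)) w| <= k * (3 / 4) ^+ m.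
  move=> iN lm; rewrite leNgt; apply/negP => bad; apply: (nocell i iN).
  by exists m => //; exists l.
(* Chaining costs 3 k in each of the two end cells, and crossing one grid step costs k. *)
have -> : 56 * Num.sqrt (delta * lam) = 2 * (3 * k) + k by rewrite /k; ring.
apply: (@grid_modulus R (W ^~ w) G s delta N) => //.
- by rewrite mulr_ge0.
- move=> i iN; have := steps i 0%N 0%N iN isT.
  by rewrite expr0 mulr1 divr1 mul0r addr0 -addrA -mulrDl natr1.
- move=> i r iN ir ri.
  have i0 : 0 <= s + i%:R * delta by rewrite addr_ge0// mulr_ge0// ltW.
  apply: (dyadic_chaining (brownian_path_continuous w) i0 d0 k0) => //.
  - by move=> m l lm; exact: steps.
  - by move: ri; rewrite -natr1; lra.
Qed.

Lemma grid_good_linear_modulus s delta (N : nat) lam w :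
  0 <= s -> 0 < delta -> 0 <= lam -> ~ grid_bad s delta N lam w ->
  linear_modulus (W ^~ w) lam (56 * Num.sqrt (delta * lam)) s (s + N%:R * delta).
Proof.
move=> s0 d0 lam0 good u v c su uv vN c0.
pose G (r : R) := 8 * Num.sqrt (r * lam).
have Ginc : {homo G : x y / x <= y}.
  by move=> a b ab; rewrite /G ler_wpM2l// ler_wsqrtr// ler_wpM2r.
have G0 : 0 <= G 0 by rewrite /G mulr_ge0.
apply: (le_trans (grid_good_modulus s0 d0 lam0 good Ginc G0 _ su uv vN)).
  move=> i [|j] // /andP[ij jN]; rewrite leNgt; apply/negP => bad; apply: good; left.
  exists i; first exact: leq_trans ij jN.
  by exists j => //; rewrite ifT.
by rewrite lerD2r /G sqrt_le_linear// subr_ge0.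
Qed.

End brownian_modulus.

(** * Asymptotics *)

Section limits_at_infinity.
Context {R : realType}.
Implicit Types (f : R -> R) (c M : R).

Lemma pinfty_nbhs_ge M : pinfty_nbhs R [set t | M <= t].
Proof. by exists M; split; [exact: num_real|move=> t /= /ltW]. Qed.

Lemma limf_esup_le f c : (exists M, forall t, M <= t -> f t <= c) ->
  (limf_esup (fun t => (f t)%:E) (pinfty_nbhs R) <= c%:E)%E.
Proof.
move=> [M H]; rewrite limf_esupE; apply: (@le_trans _ _ (ereal_sup [set (f t)%:E | t in [set t | M <= t]])).
  apply: ereal_inf_lbound.
  by exists [set t | M <= t] => //; exact: pinfty_nbhs_ge.
by apply: ge_ereal_sup => _ [t Mt <-]; rewrite lee_fin; exact: H.
Qed.

Lemma limf_esup_ge f c : (forall e, 0 < e -> forall M, exists2 t, M <= t & c - e <= f t) ->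
  (c%:E <= limf_esup (fun t => (f t)%:E) (pinfty_nbhs R))%E.
Proof.
move=> H; rewrite limf_esupE; apply: le_ereal_inf_tmp => _ [V [M [_ MV]] <-].
(* A neighbourhood of infinity only contains the t > M, with strict inequality; hence the shift by
   1. *)
apply/lee_addgt0Pr => e e0; have [t Mt ft] := H e e0 (M + 1).
rewrite -leeBlDr//; apply: (@le_trans _ _ (f t)%:E); first by rewrite -EFinB lee_fin.
by apply: ereal_sup_ubound; exists t => //; apply: MV; lra.
Qed.

Lemma limf_einf_ge f c : (exists M, forall t, M <= t -> c <= f t) ->
  (c%:E <= limf_einf (fun t => (f t)%:E) (pinfty_nbhs R))%E.
Proof.
move=> [M H]; rewrite /limf_einf leeNr -EFinN; apply: (@limf_esup_le (fun t => - f t)).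
by exists M => t Mt; rewrite lerN2; exact: H.
Qed.

Lemma limf_einf_le f c : (forall e, 0 < e -> forall M, exists2 t, M <= t & f t <= c + e) ->
  (limf_einf (fun t => (f t)%:E) (pinfty_nbhs R) <= c%:E)%E.
Proof.
move=> H; rewrite /limf_einf leeNl -EFinN; apply: (@limf_esup_ge (fun t => - f t)).
by move=> e e0 M; have [t Mt ft] := H e e0 M; exists t => //; lra.
Qed.

End limits_at_infinity.

Section asymptotics.
Context {R : realType}.

Lemma sqrt_eventually_ge (B : R) : exists K, forall k, (K <= k)%N -> B <= Num.sqrt k%:R.
Proof.
exists (Num.truncn (B ^+ 2)).+1 => k Kk.
have Bk : B ^+ 2 <= k%:R.
  apply: (@le_trans _ _ (Num.truncn (B ^+ 2)).+1%:R); last by rewrite ler_nat.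
  by rewrite ltW// truncnS_gt.
by rewrite (le_trans (ler_norm B))// -sqrtr_sqr ler_wsqrtr.
Qed.

Lemma nat_eventually_ge (B : R) : exists K, forall k, (K <= k)%N -> B <= k%:R.
Proof.
exists (Num.truncn B).+1 => k Kk.
apply: (@le_trans _ _ (Num.truncn B).+1%:R); last by rewrite ler_nat.
by rewrite ltW// truncnS_gt.
Qed.

Lemma sqr_natr_le_expR : exists2 C : R, 0 < C &
  forall n, (n%:R : R) ^+ 2 <= C * expR (n%:R / 10).
Proof.
exists 400 => [|n]; first by rewrite ltr0n.
have e : (n%:R : R) <= 20 * expR (n%:R / 20).
  by have := expR_ge1Dx (n%:R / 20 : R); lra.
have -> : expR (n%:R / 10) = expR (n%:R / 20) ^+ 2 :> R.
  by rewrite -expRM_natl; congr expR; field.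
have -> : 400 * expR (n%:R / 20) ^+ 2 = (20 * expR (n%:R / 20)) ^+ 2 :> R by ring.
by rewrite lerXn2r ?nnegrE// mulr_ge0// expR_ge0.
Qed.

Lemma truncn_expR (x : R) : 0 <= x ->
  expR x / 2 <= (Num.truncn (expR x))%:R /\ (Num.truncn (expR x))%:R <= expR x.
Proof.
move=> x0; have e1 : 1 <= expR x by rewrite -expR0 ler_expR.
have /andP[h1 h2] := truncn_itv (expR_ge0 x).
split=> //; rewrite -natr1 in h2.
have : 1 <= (Num.truncn (expR x))%:R :> R.
  by rewrite ler1n truncn_gt0.
lra.
Qed.

(* The expected number of deviations of cost [(1 - eps)^2 a^2] among [exp (a^2)]
   trials is unbounded in [a]. *)
Lemma many_trials (a eps p : R) : 0 <= a -> 0 < eps -> eps <= 1 ->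
  expR (- (((1 - eps) * (Num.sqrt 2 * a) + 1) ^+ 2 / 2)) / 3 <= p ->
  (eps * a ^+ 2 - 2 * a - 1) / 6 <= (Num.truncn (expR (a ^+ 2)))%:R * p.
Proof.
move=> a0 e0 e1 hp.
have [h1 _] := truncn_expR (sqr_ge0 a).
set N := _%:R in h1 *.
set x := (1 - eps) * _ in hp.
have s2 : Num.sqrt (2 : R) ^+ 2 = 2 by rewrite sqr_sqrtr.
have s20 : 0 <= Num.sqrt (2 : R) by exact: sqrtr_ge0.
have s22 : Num.sqrt (2 : R) <= 2 by nra.
have xE : (x + 1) ^+ 2 / 2 = (1 - eps) ^+ 2 * a ^+ 2 + x + 1 / 2.
  have -> : (x + 1) ^+ 2 / 2 = x ^+ 2 / 2 + x + 1 / 2 by field.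
  by rewrite /x !exprMn s2; field.
have xle : x <= 2 * a.
  have : Num.sqrt 2 * a <= 2 * a by rewrite ler_wpM2r.
  have : 0 <= Num.sqrt 2 * a by rewrite mulr_ge0.
  by rewrite /x; nra.
have ep0 : 0 < expR (- ((x + 1) ^+ 2 / 2)) by exact: expR_gt0.
apply: (@le_trans _ _ (expR (a ^+ 2) / 2 * (expR (- ((x + 1) ^+ 2 / 2)) / 3))).
  have -> : expR (a ^+ 2) / 2 * (expR (- ((x + 1) ^+ 2 / 2)) / 3)
    = expR (a ^+ 2 - (x + 1) ^+ 2 / 2) / 6 by rewrite expRD; field.
  rewrite ler_pM2r//; apply: le_trans (expR_ge1Dx _).
  by rewrite xE; nra.
by apply: ler_pM.
Qed.

End asymptotics.

(** * Brownian increments up to exponential times *)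

Section exponential_scales.
Context {R : realType} {d : measure_display} {T : measurableType d}.
Context (P : probability T R) (W : R -> T -> R) (BM : std_brownian_motion P W).
Implicit Types (m n : nat).

(** An integer horizon beyond exp (n + 1), so that scale n covers every t with n <= ln t < n + 1. *)
Definition scale_horizon n : nat := (Num.truncn (expR n.+1%:R : R)).+1.
(** The mesh times the level n is 1 / m, so the additive error of the modulus does not depend on n
    and is made small by the choice of m. *)
Definition scale_mesh m n : R := (n * m)%:R^-1.
Definition scale_cells m n : nat := (scale_horizon n * (n * m))%N.

(** A sharper linear bound for nearby grid times. In [scale_bad] the range M delta is 80, beyond
    which [pair_bad] already gives a good enough bound. *)
Definition near_bad (delta c : R) (N M : nat) := \bigcup_(i < N) \bigcup_(j < M)
  jump W (i%:R * delta) ((i + j.+1)%:R * delta) (c * (1 + j.+1%:R * delta)).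

Definition scale_bad m n :=
  grid_bad W 0 (scale_mesh m n) (scale_cells m n) n%:R `|`
  near_bad (scale_mesh m n) (9 / 10 * Num.sqrt n%:R) (scale_cells m n) (80 * (n * m)).

Lemma scale_horizonP n : expR n.+1%:R <= (scale_horizon n)%:R :> R /\
  (scale_horizon n)%:R <= expR (n%:R + 2) :> R.
Proof.
have /andP[h1 h2] := truncn_itv (expR_ge0 (n.+1%:R : R)).
split; first exact: ltW.
rewrite /scale_horizon -natr1; apply: (@le_trans _ _ (expR n.+1%:R + 1)).
  by rewrite lerD2r.
have -> : n%:R + 2 = n.+1%:R + 1 :> R by rewrite -natr1; ring.
rewrite [expR (_ + 1)]expRD.
have e1 : 1 <= expR (n.+1%:R : R) by rewrite -expR0 ler_expR.
have := expR_ge1Dx (1 : R); nra.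
Qed.

(** Since (1 + r)^2 / r >= 4, the cost of each deviation is at least 3/2 c^2, uniformly in the
    distance r. *)
Lemma near_bad_bounded (delta c : R) (N M : nat) : 0 < delta -> 0 <= c ->
  rel_bounded P setT (near_bad delta c N M)
    (N%:R * (M%:R * (2 * expR (- (3 / 2 * c ^+ 2))))).
Proof.
move=> d0 c0; apply: rel_bounded_ord => // i _; apply: rel_bounded_ord => // j _.
have r0 : 0 < j.+1%:R * delta by rewrite mulr_gt0.
apply: (jump_rel_bounded BM _ (@jump_independent_setT _ _ _ P W ((i + j.+1)%:R * delta))) => //.
- by rewrite mulr_ge0// ltW.
- by rewrite ltr_pM2r// ltr_nat addnS ltnS leq_addr.
- by rewrite mulr_ge0// addr_ge0// ltW.
have -> : (i + j.+1)%:R * delta - i%:R * delta = j.+1%:R * delta.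
  by rewrite natrD; ring.
move: (j.+1%:R * delta) r0 => r r0.
rewrite ler_pM2l// ler_expR lerN2 exprMn.
have -> : 3 / 8 * (c ^+ 2 * (1 + r) ^+ 2) / r = 3 / 8 * c ^+ 2 * ((1 + r) ^+ 2 / r).
  by field; rewrite gt_eqF.
have : 4 <= (1 + r) ^+ 2 / r.
  by rewrite ler_pdivlMr//; have := sqr_ge0 (1 - r); nra.
have := sqr_ge0 c; nra.
Qed.

(** The slope 9/10 sqrt n gives a cost 243/200 n, more than the n from the number of cells, of order
    exp n; the surplus absorbs the polynomial factor, bounded by exp (n / 10), and leaves exp (- n /
    10). For the grid events, 24 n outweighs the squared number of cells. *)
Lemma scale_bad_prob m : (0 < m)%N -> exists2 C : R, 0 <= C &
  forall n, (0 < n)%N -> measurable (scale_bad m n) /\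
  (P (scale_bad m n) <= (C * expR (- (1 / 10)) ^+ n)%:E)%E.
Proof.
move=> m0.
have [C C_gt0 HC] := @sqr_natr_le_expR R.
have C0 := ltW C_gt0.
exists (((6 * C) * expR 4 + (160 * C) * expR 2) * m%:R ^+ 2).
  by rewrite mulr_ge0 ?sqr_ge0 ?addr_ge0 ?mulr_ge0 ?expR_ge0.
move=> n n0.
have nm0 : (0 < n * m)%N by rewrite muln_gt0 n0.
have d0 : 0 < scale_mesh m n by rewrite invr_gt0 ltr0n.
have c0 : 0 <= 9 / 10 * Num.sqrt n%:R :> R by rewrite mulr_ge0.
have n1 : 1 <= n%:R :> R by rewrite ler1n.
have g1 := grid_bad_bounded BM measurableT (@jump_independent_setT _ _ _ P W _) (lexx 0) d0 n1.
have g2 := near_bad_bounded (scale_cells m n) (80 * (n * m)) d0 c0.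
have [mB] := rel_bounded_setU measurableT (g1 (scale_cells m n)) g2.
rewrite setIT probability_setT mule1 => PB; split=> //.
apply: (le_trans PB); rewrite lee_fin.
have [_ K1] := scale_horizonP n.
have -> : (3 / 2 * (9 / 10 * Num.sqrt n%:R) ^+ 2 : R) = 243 / 200 * n%:R.
  by rewrite exprMn sqr_sqrtr//; field.
rewrite /scale_cells !natrM.
set K : R := (scale_horizon n)%:R in K1 *.
have K0 : 0 <= K by [].
set x : R := n%:R in n1 K1 *; set M : R := m%:R.
have M0 : 0 <= M by [].
have x2 : x ^+ 2 <= C * expR (x / 10) by exact: HC.
have Kx : (K * (x * M)) ^+ 2 <= expR (x + 2) ^+ 2 * (C * expR (x / 10)) * M ^+ 2.
  rewrite !exprMn mulrA ler_wpM2r ?sqr_ge0//; apply: ler_pM; rewrite ?sqr_ge0//.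
  by rewrite lerXn2r ?nnegrE// expR_ge0.
have Kx' : K * (x * M) * (80 * (x * M)) <=
   80 * (expR (x + 2) * (C * expR (x / 10)) * M ^+ 2).
  have -> : K * (x * M) * (80 * (x * M)) = 80 * (K * x ^+ 2 * M ^+ 2) by ring.
  rewrite ler_pM2l// ler_wpM2r ?sqr_ge0//; apply: ler_pM; rewrite ?sqr_ge0//.
have e1 : 0 <= expR (- (24 * x)) by exact: expR_ge0.
have e2 : 0 <= expR (- (243 / 200 * x)) by exact: expR_ge0.
have -> : expR (- (1 / 10)) ^+ n = expR (- (x / 10)).
  by rewrite -expRM_natl; congr expR; rewrite /x; field.
have t1 : 6 * (K * (x * M)) ^+ 2 * expR (- (24 * x)) <=
    (6 * C) * expR 4 * M ^+ 2 * expR (- (x / 10)).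
  apply: (@le_trans _ _ (6 * (expR (x + 2) ^+ 2 * (C * expR (x / 10)) * M ^+ 2) * expR (- (24 * x)))).
    by rewrite ler_wpM2r// ler_pM2l.
  have -> : 6 * (expR (x + 2) ^+ 2 * (C * expR (x / 10)) * M ^+ 2) * expR (- (24 * x)) =
    (6 * C) * M ^+ 2 * (expR (x + 2) ^+ 2 * expR (x / 10) * expR (- (24 * x))) by ring.
  have -> : (6 * C) * expR 4 * M ^+ 2 * expR (- (x / 10)) =
    (6 * C) * M ^+ 2 * (expR 4 * expR (- (x / 10))) by ring.
  rewrite ler_wpM2l ?mulr_ge0 ?sqr_ge0//.
  rewrite -expRM_natl -!expRD ler_expR; lra.
have t2 : K * (x * M) * (80 * (x * M) * (2 * expR (- (243 / 200 * x)))) <=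
    (160 * C) * expR 2 * M ^+ 2 * expR (- (x / 10)).
  have -> : K * (x * M) * (80 * (x * M) * (2 * expR (- (243 / 200 * x)))) =
    K * (x * M) * (80 * (x * M)) * (2 * expR (- (243 / 200 * x))) by ring.
  apply: (@le_trans _ _ (80 * (expR (x + 2) * (C * expR (x / 10)) * M ^+ 2) *
     (2 * expR (- (243 / 200 * x))))).
    by apply: ler_wpM2r => //; rewrite mulr_ge0.
  have -> : 80 * (expR (x + 2) * (C * expR (x / 10)) * M ^+ 2) *
     (2 * expR (- (243 / 200 * x))) =
    (160 * C) * M ^+ 2 * (expR (x + 2) * expR (x / 10) * expR (- (243 / 200 * x))) by ring.
  have -> : (160 * C) * expR 2 * M ^+ 2 * expR (- (x / 10)) =
    (160 * C) * M ^+ 2 * (expR 2 * expR (- (x / 10))) by ring.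
  rewrite ler_wpM2l ?mulr_ge0 ?sqr_ge0//.
  rewrite -!expRD ler_expR; lra.
have := lerD t1 t2; move: (6 * C * expR 4) (160 * C * expR 2) => A B.
by rewrite -!mulrDl.
Qed.

Lemma ae_scale_good m : (0 < m)%N ->
  {ae P, forall w, exists N, forall n, (N <= n)%N -> ~ scale_bad m n w}.
Proof.
move=> m0.
have [C C0 HC] := scale_bad_prob m0.
have r0 : 0 <= expR (- (1 / 10) : R) by exact: expR_ge0.
have r1 : expR (- (1 / 10) : R) < 1 by rewrite expR_lt1; lra.
have : {ae P, forall w, exists N, forall n, (N <= n)%N -> ~ scale_bad m n.+1 w}.
  apply: (@ae_eventually_not _ _ _ P _ C _ C0 r0 r1) => n.
    exact: (HC n.+1 (ltn0Sn n)).1.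
  apply: (le_trans (HC n.+1 (ltn0Sn n)).2).
  by rewrite lee_fin ler_wpM2l// exprS ger_pMl ?(ltW r1)// exprn_gt0// expR_gt0.
apply: filterS => w [N HN]; exists N.+1 => -[|n]//; exact: HN.
Qed.

Lemma scale_mesh_cells m n : (0 < m)%N -> (0 < n)%N ->
  0 + (scale_cells m n)%:R * scale_mesh m n = (scale_horizon n)%:R.
Proof.
move=> m0 n0; rewrite add0r /scale_cells /scale_mesh natrM mulfK//.
by rewrite pnatr_eq0 -lt0n muln_gt0 n0.
Qed.

Lemma scale_mesh_level m n : (0 < m)%N -> (0 < n)%N ->
  scale_mesh m n * n%:R = m%:R^-1.
Proof.
move=> m0 n0; rewrite /scale_mesh natrM; field.
by rewrite !pnatr_eq0 -!lt0n m0 n0.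
Qed.

Lemma scale_good_linear_modulus m n w : (0 < m)%N -> (0 < n)%N -> ~ scale_bad m n w ->
  linear_modulus (W ^~ w) n%:R (56 * Num.sqrt m%:R^-1) 0 (scale_horizon n)%:R.
Proof.
move=> m0 n0 good.
have d0 : 0 < scale_mesh m n by rewrite invr_gt0 ltr0n muln_gt0 n0.
have good' : ~ grid_bad W 0 (scale_mesh m n) (scale_cells m n) n%:R w.
  by move=> bad; apply: good; left.
have := grid_good_linear_modulus BM (lexx 0) d0 (ler0n _ _) good'.
by rewrite scale_mesh_cells// scale_mesh_level.
Qed.

(** Pairs at distance r <= 80 are controlled by [near_bad]. For r >= 80 one has 8 sqrt r <= 9/10 (1
    + r), so the square-root modulus suffices. *)
Lemma scale_good_increment m n w u v : (0 < m)%N -> (0 < n)%N -> ~ scale_bad m n w ->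
  0 <= u -> u <= v -> v <= (scale_horizon n)%:R ->
  `|W v w - W u w| <= 9 / 10 * Num.sqrt n%:R * (1 + (v - u)) + 56.
Proof.
move=> m0 n0 good u0 uv vK.
have nm0 : (0 < n * m)%N by rewrite muln_gt0 n0.
have d0 : 0 < scale_mesh m n by rewrite invr_gt0 ltr0n.
have good' : ~ grid_bad W 0 (scale_mesh m n) (scale_cells m n) n%:R w.
  by move=> bad; apply: good; left.
have c0 : 0 <= 9 / 10 * Num.sqrt n%:R :> R by rewrite mulr_ge0.
pose G (r : R) := 9 / 10 * Num.sqrt n%:R * (1 + r).
have Ginc : {homo G : x y / x <= y} by move=> a b ab; rewrite /G ler_wpM2l// lerD2l.
have G0 : 0 <= G 0 by rewrite /G addr0 mulr1.
have pairs i j : (i < j <= scale_cells m n)%N ->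
     `|W (0 + j%:R * scale_mesh m n) w - W (0 + i%:R * scale_mesh m n) w| <=
     G ((j - i)%:R * scale_mesh m n).
  move=> /andP[ij jN]; have [near|far] := leqP (j - i) (80 * (n * m)).
    rewrite leNgt; apply/negP => bad; apply: good; right.
    exists i; first exact: leq_trans ij jN.
    exists (j - i).-1; first by rewrite /= prednK// subn_gt0.
    rewrite prednK ?subn_gt0// subnKC; last exact: ltnW.
    by move: bad; rewrite !add0r.
  have mod : `|W (0 + j%:R * scale_mesh m n) w - W (0 + i%:R * scale_mesh m n) w| <=
    8 * Num.sqrt ((j - i)%:R * scale_mesh m n * n%:R).
    rewrite leNgt; apply/negP => bad; apply: good'; left.
    case: j ij jN far bad => // j ij jN far bad.
    by exists i; [exact: leq_trans ij jN|exists j; [|rewrite ifT]].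
  apply: (le_trans mod).
  have : 80 <= (j - i)%:R * scale_mesh m n.
    by rewrite /scale_mesh ler_pdivlMr ?ltr0n// -natrM ler_nat ltnW.
  rewrite /G; move: (_ * scale_mesh m n) => r r80.
  rewrite sqrtrM; last by lra.
  have s0 := sqrtr_ge0 (n%:R : R).
  have : 8 * Num.sqrt r <= 9 / 10 * (1 + r).
    have rE : Num.sqrt r ^+ 2 = r by rewrite sqr_sqrtr//; lra.
    have := sqrtr_ge0 r; set z := Num.sqrt r in rE *; move: rE => <- z0.
    have z8 : 80 <= z ^+ 2 by rewrite sqr_sqrtr//; lra.
    have : 8 <= z by nra.
    nra.
  move: (Num.sqrt n%:R) (Num.sqrt r) s0 => a b a0; nra.
have := grid_good_modulus BM (lexx 0) d0 (ler0n _ _) good' Ginc G0 pairs u0 uv.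
rewrite scale_mesh_cells// scale_mesh_level// => /(_ vK) /le_trans; apply.
rewrite lerD2l ger_pMr// -[leRHS]sqrtr1 ler_wsqrtr// invf_le1 ?ltr0n//.
by rewrite ler1n.
Qed.

End exponential_scales.

(** * Growth bounds *)

Section growth.
Context {R : realType} {d : measure_display} {T : measurableType d}.
Context (P : probability T R) (W : R -> T -> R) (BM : std_brownian_motion P W).
Context (beta x y : R) (Q1 Q2 L : R -> T -> R).
Context (sol : forall w, reflected_solution beta x y (fun t => W t w)
               (fun t => Q1 t w) (fun t => Q2 t w) (fun t => L t w)).

Lemma find_scale n0 (t : R) : expR n0%:R <= t ->
  exists n, [/\ (n0 <= n)%N, n%:R <= ln t & t <= (@scale_horizon R n)%:R].
Proof.
move=> n0t; have t0 : 0 < t by apply: lt_le_trans n0t; exact: expR_gt0.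
have ln0 : n0%:R <= ln t by rewrite -[n0%:R]expRK ler_ln ?posrE ?expR_gt0.
have lnt : 0 <= ln t by exact: le_trans ln0.
exists (Num.truncn (ln t)); have /andP[h1 h2] := truncn_itv lnt.
split => //; first by rewrite truncn_ge_nat.
have [/(le_trans _) K _] := @scale_horizonP R (Num.truncn (ln t)).
by apply: K; rewrite -[leLHS]lnK ?posrE// ler_expR ltW.
Qed.

Lemma theta_small m : 0 < beta -> (0 < m)%N -> 336 / beta <= Num.sqrt m%:R ->
  3 / 2 * (56 * Num.sqrt m%:R^-1) <= beta / 4.
Proof.
move=> b0 m0 sm; have sm0 : 0 < Num.sqrt m%:R :> R by rewrite sqrtr_gt0 ltr0n.
rewrite sqrtrV// ler_pdivrMr// in sm *.
have -> : 3 / 2 * (56 / Num.sqrt m%:R) = 84 / Num.sqrt m%:R :> R by field; rewrite gt_eqF.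
by rewrite ler_pdivrMr//; lra.
Qed.

(** At the scale n of t, the pathwise bounds hold with level n <= ln t. The slacks between 9/10 and
    1 and between 288 and 300 absorb all constants once n is large. *)
Lemma ae_growth : 0 < beta -> 0 < y ->
  {ae P, forall w, exists M, forall t, M <= t ->
     - (2 * Num.sqrt 2) * Num.sqrt (ln t) <= Q1 t w /\
     Q2 t w <= 300 / beta * ln t}.
Proof.
move=> b0 y0.
have [m [m0 sm]] : exists m, (0 < m)%N /\ 336 / beta <= Num.sqrt m%:R.
  have [K HK] := sqrt_eventually_ge (336 / beta).
  by exists K.+1; split=> //; apply: HK.
have theta := theta_small b0 m0 sm.
apply: filterS (ae_scale_good BM m0) => w [N good].
(* From here on, a tenth of sqrt n outweighs the constants 56 and [beta] in [a], and [a] exceeds the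
   initial value [- x]. *)
have [N1 HN1] := sqrt_eventually_ge (560 + 10 * beta + 2 * `|x|).
have [N2 HN2] := nat_eventually_ge (y * beta + beta ^+ 2).
exists (expR (maxn (maxn N 1) (maxn N1 N2))%:R) => t.
move=> /find_scale [n []]; rewrite !geq_max => /andP[/andP[Nn n0] /andP[N1n N2n]] nlt tK.
have {}good := good n Nn.
have sn : 560 + 10 * beta + 2 * `|x| <= Num.sqrt n%:R by exact: HN1.
have nbig : y * beta + beta ^+ 2 <= n%:R by exact: HN2.
(* [ln] takes the value 0 at nonpositive arguments, whereas here ln t >= n > 0. *)
have t0 : 0 <= t.
  rewrite leNgt; apply/negP => t0.
  by move: nlt; rewrite (ln0 (ltW t0)) lern0 eqn0Ngt n0.
have W0 : W 0 w = 0 by case: BM => _ + _ _; apply.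
have x0 := normr_ge0 x; have xx : - x <= `|x| by rewrite -normrN ler_norm.
have s2 : 1 <= Num.sqrt (2 : R) by rewrite -[leLHS]sqrtr1 ler_wsqrtr//; lra.
split.
  set s := Num.sqrt n%:R in sn.
  have s0 : 0 <= s by exact: sqrtr_ge0.
  pose a := Num.sqrt 2 * (9 / 10 * s + 56) + beta.
  have a0 : 0 <= a by rewrite /a; nra.
  have bound u : 0 <= u -> u <= t ->
      - (Num.sqrt 2 * (W t w - W u w)) + beta * (t - u) <= a * (1 + (t - u)).
    move=> u0 ut; have := scale_good_increment BM m0 n0 good u0 ut tK.
    rewrite -/s => h.
    have : - (Num.sqrt 2 * (W t w - W u w)) <= Num.sqrt 2 * `|W t w - W u w|.
      by rewrite -mulrN ler_wpM2l// -normrN ler_norm.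
    have : Num.sqrt 2 * `|W t w - W u w| <=
        Num.sqrt 2 * (9 / 10 * s * (1 + (t - u)) + 56) by rewrite ler_wpM2l.
    have h0 : 0 <= t - u by lra.
    have : 0 <= Num.sqrt 2 * 56 * (t - u) by rewrite !mulr_ge0.
    by rewrite /a; lra.
  have start : - Q1 0 w <= a.
    rewrite (q1_start (sol w)) W0 mulr0 addr0 /a.
    have : 9 / 10 * s + 56 <= Num.sqrt 2 * (9 / 10 * s + 56).
      by rewrite ler_peMl//; lra.
    by lra.
  have := q1_lower_bound (sol w) (ltW y0) t0 a0 start bound.
  have : s <= Num.sqrt (ln t) by rewrite ler_wsqrtr.
  have : 2 * a <= 2 * Num.sqrt 2 * s by rewrite /a; nra.
  by nra.
have lam0 : 0 < n%:R :> R by rewrite ltr0n.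
have mod := scale_good_linear_modulus BM m0 n0 good.
have mod' : linear_modulus (W ^~ w) n%:R (56 * Num.sqrt m%:R^-1) 0 t.
  by move=> u v c u0 uv vt c0; apply: mod => //; exact: le_trans vt tK.
have start : Q2 0 w <= busy_level beta n%:R.
  rewrite (q2_start (sol w)) /busy_level.
  have : y <= n%:R / beta by rewrite ler_pdivlMr//; nra.
  have : 0 <= n%:R / beta by rewrite divr_ge0// ltW.
  have -> : 144 * n%:R / beta = 144 * (n%:R / beta) by rewrite mulrA.
  by lra.
have := q2_upper_bound (sol w) b0 (ltW y0) lam0 theta (lexx 0) t0 mod' start.
move=> /le_trans; apply.
apply: (@le_trans _ _ (300 / beta * n%:R)); last first.
  by apply: ler_wpM2l nlt; rewrite divr_ge0 ?ler0n ?(ltW b0).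
have -> : 288 * n%:R / beta = 288 * (n%:R / beta) by rewrite mulrA.
have -> : 300 / beta * n%:R = 300 * (n%:R / beta) by rewrite mulrAC mulrA.
have : beta <= n%:R / beta by rewrite ler_pdivlMr//; nra.
by lra.
Qed.

End growth.

(** * Rare events that recur among exponentially many trials *)

Section recurrent_trials.
Context {R : realType} {d : measure_display} {T : measurableType d}.
Context (P : probability T R).

Lemma quadratic_eventually_ge (eps B a : R) : 0 < eps -> 0 <= B -> 1 <= a ->
  (3 + 6 * B) / eps <= a -> B <= (eps * a ^+ 2 - 2 * a - 1) / 6.
Proof.
move=> e0 B0 a1; rewrite ler_pdivrMr// => h; rewrite ler_pdivlMr//.
by nra.
Qed.

(** By [many_trials] the expected number of successes at rank k tends to infinity, and a success is
    spoiled with conditional probability at most [err k]. By [second_moment] the probability that no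
    unspoiled success occurs at rank k tends to 0. *)
Lemma io_trials (D F : nat -> nat -> set T) (a p err : nat -> R) (eps : R) :
  0 < eps -> eps <= 1 ->
  (forall B, exists K, forall k, (K <= k)%N -> B <= a k) ->
  (forall e, 0 < e -> exists K, forall k, (K <= k)%N -> err k <= e) ->
  (forall k i, measurable (D k i)) -> (forall k i, measurable (F k i)) ->
  (forall k i, (0 < k)%N -> P (D k i) = (p k)%:E) ->
  (forall k i j, (0 < k)%N -> (i < j)%N -> P (D k i `&` D k j) = (p k * p k)%:E) ->
  (forall k i, (0 < k)%N -> (P (F k i `&` D k i) <= (err k * p k)%:E)%E) ->
  (forall k, (0 < k)%N ->
    expR (- (((1 - eps) * (Num.sqrt 2 * a k) + 1) ^+ 2 / 2)) / 3 <= p k) ->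
  {ae P, forall w, forall N, exists k i, [/\ (N <= k)%N,
     (i < Num.truncn (expR (a k ^+ 2)))%N, D k i w & ~ F k i w]}.
Proof.
move=> e0 e1 aoo err0 mD mF PD PDD PFD pge.
pose tr k := Num.truncn (expR (a k ^+ 2)).
pose G k := \bigcup_(i < tr k) (D k i `\` F k i).
have mG k : measurable (G k).
  by apply: bigcup_measurable => i _; exact: measurableD.
have small (e : R) : 0 < e ->
    exists N, forall n, (N <= n)%N -> (P (~` G n) <= e%:E)%E.
  move=> ep; have e4 : 0 < e / 4 by lra.
  have B0 : 0 <= 8 / e by rewrite divr_ge0// ltW.
  (* At least 8 / e expected successes bring the variance term of [second_moment] below e / 2; the
     bound e / 4 on [err] accounts for the other half. *)
  have [K1 HK1] := aoo (Num.max 1 ((3 + 6 * (8 / e)) / eps)).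
  have [K2 HK2] := err0 _ e4.
  exists (maxn 1 (maxn K1 K2)) => k; rewrite !geq_max => /andP[k0 /andP[k1 k2]].
  have := HK1 k k1; rewrite ge_max => /andP[a1 abig].
  have many := quadratic_eventually_ge e0 B0 a1 abig.
  have a0 : 0 <= a k by lra.
  have {}many := le_trans many (many_trials a0 e0 e1 (pge k k0)).
  have p0 : 0 < p k.
    by apply: lt_le_trans (pge k k0); rewrite divr_gt0// expR_gt0.
  have tr0 : (0 < tr k)%N.
    by rewrite /tr truncn_gt0 -expR0 ler_expR sqr_ge0.
  apply: (le_trans (second_moment tr0 p0 (mD k) (mF k) (fun i => PD k i k0)
    (fun i j => @PDD k i j k0) (fun i => PFD k i k0))).
  rewrite lee_fin; have := HK2 k k2.
  have mu0 : 0 < (tr k)%:R * p k by rewrite mulr_gt0// ltr0n.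
  suff : 4 / ((tr k)%:R * p k) <= e / 2 by lra.
  rewrite ler_pdivrMr//.
  move: many; rewrite -/(tr k) ler_pdivrMr//; lra.
apply: filterS (ae_infinitely_often mG small) => w io N.
by have [k Nk [i /= itr [Di Fi]]] := io N; exists k, i.
Qed.

End recurrent_trials.

Section deviations.
Context {R : realType} {d : measure_display} {T : measurableType d}.
Context (P : probability T R) (W : R -> T -> R) (BM : std_brownian_motion P W).
Implicit Types (u v x : R).

Lemma measurable_ge x : measurable [set z : R | x <= z].
Proof.
have -> : [set z : R | x <= z] = `[x, +oo[%classic by rewrite set_itvE.
exact: measurable_itv.
Qed.

Lemma measurable_le x : measurable [set z : R | z <= x].
Proof.
have -> : [set z : R | z <= x] = `]-oo, x]%classic by rewrite set_itvE.
exact: measurable_itv.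
Qed.

Lemma normal_prob_ge (s x : R) : 0 < s -> 0 <= x ->
  ((expR (- ((x + 1) ^+ 2 / 2)) / 3)%:E <= normal_prob 0 s [set z | s * x <= z]%R)%E.
Proof.
move=> s0 x0; have sx : 0 <= s * x by rewrite mulr_ge0// ltW.
apply: (normal_prob_lower (p := s * x)) => //.
- exact: measurable_ge.
- by lra.
- by lra.
- by move=> z /=; rewrite in_itv/= => /andP[].
Qed.

Lemma normal_prob_le (s x : R) : 0 < s -> 0 <= x ->
  ((expR (- ((x + 1) ^+ 2 / 2)) / 3)%:E <= normal_prob 0 s [set z | z <= - (s * x)]%R)%E.
Proof.
move=> s0 x0; have sx : 0 <= s * x by rewrite mulr_ge0// ltW.
apply: (normal_prob_lower (p := - (s * (x + 1)))) => //.
- exact: measurable_le.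
- by lra.
- by move=> z /=; rewrite in_itv/= => /andP[]; lra.
Qed.

Lemma increment_prob_fin u v (A : set R) (s p : R) : 0 <= u -> u < v ->
  v - u = s -> measurable A -> p = fine (normal_prob 0 (Num.sqrt s) A) ->
  P (increment_in W u v A) = p%:E.
Proof.
move=> u0 uv <- mA ->; rewrite (increment_prob BM)// fineK//.
by rewrite -(increment_prob BM)// fin_num_measure//; exact: measurable_increment_in BM _ _ _ _.
Qed.

Lemma fine_normal_prob_ge (s r : R) (A : set R) : 0 < s -> measurable A ->
  (r%:E <= normal_prob 0 (Num.sqrt s) A)%E ->
  r <= fine (normal_prob 0 (Num.sqrt s) A).
Proof.
move=> s0 mA h; have := increment_prob_fin (lexx 0) s0 (subr0 s) mA erefl.
by rewrite (increment_prob BM)// subr0 => E; rewrite -lee_fin -E.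
Qed.

End deviations.

(** * Peaks of Q2 *)

Section queue_peaks.
Context {R : realType} {d : measure_display} {T : measurableType d}.
Context (P : probability T R) (W : R -> T -> R) (BM : std_brownian_motion P W).
Context (beta x y : R) (Q1 Q2 L : R -> T -> R).
Context (sol : forall w, reflected_solution beta x y (fun t => W t w)
               (fun t => Q1 t w) (fun t => Q2 t w) (fun t => L t w)).

(* The optimal path to a peak of height [k / beta] climbs at speed [beta] against
   the drift [- beta], hence during a time [k / beta^2]. *)
Definition climb_time (k : nat) : R := k%:R / beta ^+ 2.
Definition climb_start (k i : nat) : R := expR k%:R + i%:R * climb_time k.
Definition climb_level (eps : R) (k : nat) : R :=
  (1 - eps) * (Num.sqrt 2 * Num.sqrt k%:R).
Definition climb (eps : R) (k i : nat) :=
  increment_in W (climb_start k i) (climb_start k i.+1)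
    [set z | Num.sqrt (climb_time k) * climb_level eps k <= z].

(** The windows of rank k do not overlap, so the climbs are pairwise independent; nothing spoils
    them, whence the empty sets. *)
Lemma ae_climb (eps : R) : 0 < beta -> 0 < eps -> eps <= 1 ->
  {ae P, forall w, forall N, exists k i, [/\ (N <= k)%N,
     (i < Num.truncn (expR (k%:R : R)))%N & climb eps k i w]}.
Proof.
move=> b0 e0 e1.
have ct0 k : (0 < k)%N -> 0 < climb_time k.
  by move=> k0; rewrite divr_gt0 ?ltr0n// exprn_gt0.
have step k i : climb_start k i.+1 - climb_start k i = climb_time k.
  by rewrite /climb_start -natr1; ring.
have ctge0 k : 0 <= climb_time k by rewrite divr_ge0// sqr_ge0.
have st0 k i : 0 <= climb_start k i.
  by rewrite addr_ge0 ?expR_ge0// mulr_ge0.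
have lt k i : (0 < k)%N -> climb_start k i < climb_start k i.+1.
  by move=> k0; rewrite -subr_gt0 step ct0.
have mon k i j : (i < j)%N -> climb_start k i.+1 <= climb_start k j.
  by move=> ij; rewrite lerD2l ler_wpM2r// ler_nat.
have cl0 k : 0 <= climb_level eps k.
  by rewrite mulr_ge0 ?subr_ge0// mulr_ge0.
pose p k := fine (normal_prob 0 (Num.sqrt (climb_time k))
   [set z | Num.sqrt (climb_time k) * climb_level eps k <= z]%R).
have mS k i : measurable (climb eps k i).
  by apply: (measurable_increment_in BM); exact: measurable_ge.
have Pc k i : (0 < k)%N -> P (climb eps k i) = (p k)%:E.
  move=> k0; apply: (increment_prob_fin BM (st0 k i) (lt k i k0) (step k i)) => //.
  exact: measurable_ge.
apply: filterS (@io_trials _ _ _ P (climb eps) (fun _ _ => set0)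
  (fun k => Num.sqrt k%:R) p (fun=> 0) eps e0 e1 _ _ _ _ _ _ _ _) => //.
- move=> w io N; have [k [i [Nk itr Dw _]]] := io N; exists k, i; split => //.
  by move: itr; rewrite sqr_sqrtr.
- exact: sqrt_eventually_ge.
- by move=> e ep; exists 0%N => k _; exact: ltW.
- move=> k i j k0 ij; rewrite EFinM -{1}(Pc k i k0) -(Pc k j k0).
  apply: (increment_prob2 BM) => //; try exact: measurable_ge.
  + exact: lt.
  + exact: mon.
  + exact: lt.
- by move=> k i k0; rewrite set0I measure0 mul0r.
- move=> k k0; apply: (fine_normal_prob_ge BM (ct0 k k0)); first exact: measurable_ge.
  by apply: normal_prob_ge; [rewrite sqrtr_gt0 ct0|exact: cl0].
Qed.

(** A climb adds 2 (1 - eps) k / beta, the drift takes back k / beta, and by [ae_growth] the sum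
    starts above a negative multiple of sqrt k. All windows end before exp k (1 + sqrt k / beta)^2,
    so ln t exceeds k by at most 2 sqrt k / beta. *)
Lemma ae_q2_peaks (eta : R) : 0 < beta -> 0 < y -> 0 < eta ->
  {ae P, forall w, forall M, exists2 t, M <= t & beta^-1 - eta <= Q2 t w / ln t}.
Proof.
move=> b0 y0 eta0.
pose c := beta^-1; have c0 : 0 < c by rewrite invr_gt0.
pose eps := Num.min 1 (eta * beta / 4).
have e0 : 0 < eps.
  by rewrite lt_min ltr01 divr_gt0// mulr_gt0.
have e1 : eps <= 1 by rewrite ge_min lexx.
have ec : eps * c <= eta / 4.
  apply: (@le_trans _ _ (eta * beta / 4 * c)).
    by rewrite ler_wpM2r ?(ltW c0)// ge_min lexx orbT.
  have -> // : eta * beta / 4 * c = eta / 4 by rewrite /c; field; rewrite gt_eqF.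
have := ae_growth BM sol b0 y0.
apply: filterS2 (ae_climb b0 e0 e1) => w climbs [M0 tame] M.
(* Beyond [U], half of eta u^2 dominates the terms of order u, due to [Q1] at the start of the
   window and to the gap between ln t and k; the other half pays for [eps]. *)
pose U := 1 + (6 + 4 * c ^+ 2 + 6 * c) / eta.
have U1 : 1 <= U.
  rewrite /U lerDl divr_ge0 ?(ltW eta0)//.
  by rewrite !addr_ge0// mulr_ge0// ?sqr_ge0// ltW.
have [K1 HK1] := sqrt_eventually_ge U.
have [K2 HK2] := nat_eventually_ge (Num.max M0 M).
have [k [i [Kk ilt dev]]] := climbs (maxn 1 (maxn K1 K2)).
move: Kk; rewrite !geq_max => /andP[k1 /andP[kK1 kK2]].
have uU := HK1 k kK1.
have := HK2 k kK2; rewrite ge_max => /andP[kM0 kM].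
set u := Num.sqrt k%:R in uU.
have uE : u ^+ 2 = k%:R by rewrite sqr_sqrtr.
have u1 : 1 <= u by exact: le_trans uU.
have kexp : k%:R <= expR k%:R :> R by have := expR_ge1Dx (k%:R : R); lra.
have ctE : climb_time k = u ^+ 2 * c ^+ 2.
  by rewrite /climb_time -uE /c exprVn.
have ct0 : 0 <= climb_time k by rewrite ctE mulr_ge0// sqr_ge0.
set s := climb_start k i; set t := climb_start k i.+1.
have sge : expR k%:R <= s by rewrite /s /climb_start lerDl mulr_ge0.
have stE : t - s = climb_time k by rewrite /t /s /climb_start -natr1; ring.
have st : s <= t by rewrite -subr_ge0 stE.
have s0 : 0 < s by apply: lt_le_trans sge; exact: expR_gt0.
have t0 : 0 < t by exact: lt_le_trans st.
have uc0 : 0 <= u * c by rewrite mulr_ge0 ?(ltW c0)//; lra.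
have tle : t <= expR (u ^+ 2 + 2 * (u * c)).
  have [_ tr] := @truncn_expR R k%:R (ler0n _ _).
  have itr : i.+1%:R <= expR k%:R :> R by apply: le_trans tr; rewrite ler_nat.
  rewrite /t /climb_start expRD expRM_natl uE.
  apply: (@le_trans _ _ (expR k%:R * (1 + u * c) ^+ 2)).
    have -> : (1 + u * c) ^+ 2 = 1 + 2 * (u * c) + climb_time k by rewrite ctE; ring.
    have := expR_ge0 (k%:R : R); nra.
  rewrite ler_wpM2l ?expR_ge0// lerXn2r ?nnegrE ?expR_ge0//; first by lra.
  exact: expR_ge1Dx.
have lnt : ln t <= u ^+ 2 + 2 * (u * c) by rewrite -[leRHS]expRK ler_ln ?posrE ?expR_gt0.
have lnk : u ^+ 2 <= ln t.
  by rewrite uE -[leLHS]expRK ler_ln ?posrE ?expR_gt0//; exact: le_trans st.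
have lnst : ln s <= ln t by rewrite ler_ln ?posrE.
have sq : Num.sqrt (ln s) <= u + c.
  have -> : u + c = Num.sqrt ((u + c) ^+ 2) by rewrite sqrtr_sqr ger0_norm; lra.
  rewrite ler_wsqrtr//; have := sqr_ge0 c; nra.
have [q1s _] := tame s (le_trans kM0 (le_trans kexp sge)).
have sumge := sum_increment_ge (sol w) (ltW s0) st.
have q2s := q2_ge0 (sol w) (ltW y0) (ltW s0).
have q1t := q1_le0 (sol w) (ltW t0).
have s2E : Num.sqrt (2 : R) ^+ 2 = 2 by rewrite sqr_sqrtr.
have s20 := sqrtr_ge0 (2 : R).
have rise : 2 * (1 - eps) * (u ^+ 2 * c) <= Num.sqrt 2 * (W t w - W s w).
  have -> : 2 * (1 - eps) * (u ^+ 2 * c) =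
      Num.sqrt 2 * (Num.sqrt (climb_time k) * climb_level eps k).
    have -> : Num.sqrt (climb_time k) = u * c.
      by rewrite ctE -exprMn sqrtr_sqr ger0_norm.
    rewrite /climb_level -/u -[in LHS]s2E; ring.
  by rewrite ler_wpM2l//; have := dev; rewrite /climb /increment_in/= inE.
have drop : beta * (t - s) = u ^+ 2 * c.
  by rewrite stE ctE /c; field; rewrite gt_eqF.
have noise : 2 * Num.sqrt 2 * Num.sqrt (ln s) <= 3 * (u + c).
  have s23 : Num.sqrt 2 <= 3 / 2 :> R by nra.
  have := sqrtr_ge0 (ln s); nra.
have lower : (1 - 2 * eps) * (u ^+ 2 * c) - 3 * (u + c) <= Q2 t w.
  by rewrite drop in sumge; lra.
exists t; first by apply: le_trans st; apply: le_trans sge; exact: le_trans kexp.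
have lnt0 : 0 < ln t by apply: lt_le_trans lnk; nra.
rewrite ler_pdivlMr// -/c; apply: le_trans lower.
have big : (6 + 4 * c ^+ 2 + 6 * c) * u <= eta * u ^+ 2.
  have : (6 + 4 * c ^+ 2 + 6 * c) / eta <= u by move: uU; rewrite /U; lra.
  rewrite ler_pdivrMr// => h; nra.
have upper : (c - eta) * ln t <= c * (u ^+ 2 + 2 * (u * c)) - eta * u ^+ 2 by nra.
apply: (le_trans upper).
have : eps * c * u ^+ 2 <= eta / 4 * u ^+ 2 by rewrite ler_wpM2r// sqr_ge0.
have : c <= c * u by rewrite ler_peMr// ltW.
by have := sqr_ge0 c; nra.
Qed.

End queue_peaks.

(** * Dips of Q1 *)

(** If [- q1] stayed below [a] for the unit of time, mean reversion would give back at most [a] of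
    the fall, and [q2_relaxation] bounds the sum at [v]. The sum, hence [q1], would then end below
    [- a]. *)
Lemma q1_dip (R : realType) (beta x y : R) (wp q1 q2 l : R -> R)
  (lam theta s v m a : R) :
  reflected_solution beta x y wp q1 q2 l -> 0 < beta -> 0 <= y -> 0 < lam ->
  3 / 2 * theta <= beta / 4 -> 0 <= s -> s <= v -> linear_modulus wp lam theta s v ->
  (forall r, s <= r -> r <= v -> q2 r <= m) -> 5 * m / beta <= v - s ->
  Num.sqrt 2 * (wp (v + 1) - wp v) <= - (2 * a + (288 * lam / beta + 2 * beta)) ->
  exists t, [/\ v <= t, t <= v + 1 & q1 t <= - a].
Proof.
move=> sol b0 y0 lam0 th s0 sv mod q2m len dip; apply: contrapT => nodip.
have v0 := le_trans s0 sv.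
have vv : v <= v + 1 by rewrite lerDl.
have shallow r : v < r -> r <= v + 1 -> - q1 r <= a.
  move=> vr rv; rewrite lerNl ltW// ltNge; apply/negP => h.
  by apply: nodip; exists r; rewrite (ltW vr).
have q2v := q2_relaxation sol b0 y0 lam0 th s0 sv mod q2m len.
have := sum_increment_le sol v0 vv shallow.
have := q1_le0 sol v0.
have := q2_ge0 sol y0 (le_trans v0 vv).
have e : v + 1 - v = 1 by ring.
rewrite e !mulr1 => h1 h2 h3; apply: nodip; exists (v + 1).
by rewrite vv; split => //; lra.
Qed.

Section idle_dips.
Context {R : realType} {d : measure_display} {T : measurableType d}.
Context (P : probability T R) (W : R -> T -> R) (BM : std_brownian_motion P W).
Context (beta x y : R) (Q1 Q2 L : R -> T -> R).
Context (sol : forall w, reflected_solution beta x y (fun t => W t w)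
               (fun t => Q1 t w) (fun t => Q2 t w) (fun t => L t w)).

(* Each block consists of a stretch of length [k^8], in which the queue [Q2]
   relaxes to a size of order [k], followed by a unit of time in which the
   Brownian motion pushes [Q1] down to about [- k^2]. *)
Definition block_start (k i : nat) : R := expR ((k%:R ^+ 2) ^+ 2) + i%:R * (k%:R ^+ 8 + 1).
Definition block_push (k i : nat) : R := block_start k i + k%:R ^+ 8.
Definition push_level (eps : R) (k : nat) : R := (1 - eps) * (Num.sqrt 2 * k%:R ^+ 2).
(** The factor [Num.sqrt 1] is the standard deviation of a unit-time increment, kept to match
    [normal_prob_le]. *)
Definition push (eps : R) (k i : nat) :=
  increment_in W (block_push k i) (block_push k i + 1)
    [set z | z <= - (Num.sqrt 1 * push_level eps k)].
Definition block_cells (m k : nat) : nat := (k ^ 8 * (k * m))%N.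
Definition block_bad (m k i : nat) :=
  grid_bad W (block_start k i) (scale_mesh m k) (block_cells m k) k%:R.

Lemma block_start_ge0 k i : 0 <= block_start k i.
Proof. by rewrite addr_ge0 ?expR_ge0// mulr_ge0// addr_ge0// exprn_ge0. Qed.

Lemma block_startS k i : block_push k i + 1 = block_start k i.+1.
Proof. by rewrite /block_push /block_start -natr1; ring. Qed.

Lemma block_mesh_cells m k i : (0 < m)%N -> (0 < k)%N ->
  block_start k i + (block_cells m k)%:R * scale_mesh m k = block_push k i.
Proof.
move=> m0 k0; rewrite /block_push /block_cells /scale_mesh natrM natrX mulfK//.
by rewrite pnatr_eq0 -lt0n muln_gt0 k0.
Qed.

(** The bad event of a block concerns only times before its push, so conditioning on the push leaves
    its bound intact: of order k^18 exp (- 24 k), which tends to 0. *)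
Lemma ae_push (m : nat) (eps : R) : (0 < m)%N -> 0 < eps -> eps <= 1 ->
  {ae P, forall w, forall N, exists k i, [/\ (N <= k)%N,
     (i < Num.truncn (expR ((k%:R : R) ^+ 2 ^+ 2)))%N, push eps k i w &
     ~ block_bad m k i w]}.
Proof.
move=> m0 e0 e1.
have mesh0 k : (0 < k)%N -> 0 < @scale_mesh R m k.
  by move=> k0; rewrite invr_gt0 ltr0n muln_gt0 k0.
have push0 k i : 0 <= block_push k i.
  by rewrite addr_ge0 ?block_start_ge0// exprn_ge0.
have lt k i : block_push k i < block_push k i + 1 by rewrite ltrDl.
have step k i : block_push k i + 1 - block_push k i = 1 by ring.
have mon k i j : (i < j)%N -> block_push k i + 1 <= block_push k j.
  move=> ij; rewrite block_startS /block_push.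
  apply: (@le_trans _ _ (block_start k j)); last by rewrite lerDl exprn_ge0.
  by rewrite lerD2l ler_wpM2r ?ler_nat// addr_ge0// exprn_ge0.
have pl0 k : 0 <= push_level eps k.
  by rewrite mulr_ge0 ?subr_ge0// mulr_ge0// sqr_ge0.
pose p k := fine (normal_prob 0 (Num.sqrt 1)
   [set z | z <= - (Num.sqrt 1 * push_level eps k)]%R).
have mS k i : measurable (push eps k i).
  by apply: (measurable_increment_in BM); exact: measurable_le.
have Pc k i : P (push eps k i) = (p k)%:E.
  apply: (increment_prob_fin BM (push0 k i) (lt k i) (step k i)) => //.
  exact: measurable_le.
pose err k : R := 6 * (block_cells m k)%:R ^+ 2 * expR (- (24 * k%:R)).
have bad k i : (0 < k)%N -> rel_bounded P (push eps k i) (block_bad m k i) (err k).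
  move=> k0; apply: (grid_bad_bounded BM (mS k i)).
  - rewrite block_mesh_cells//; apply: (jump_independent_increment BM) => //.
    exact: measurable_le.
  - exact: block_start_ge0.
  - exact: mesh0.
  - by rewrite ler1n.
(* At k = 0 the mesh degenerates; the empty set keeps [F] measurable for every k. *)
pose F k i := if (0 < k)%N then block_bad m k i else set0.
have small (e : R) : 0 < e -> exists K, forall k, (K <= k)%N -> err k <= e.
  move=> ep; have [K HK] := nat_eventually_ge (m%:R ^+ 2 / e).
  exists (maxn 1 K) => k; rewrite geq_max => /andP[k0 /HK]; rewrite ler_pdivrMr// => hk.
  have k1 : 1 <= k%:R :> R by rewrite ler1n.
  have kexp : k%:R <= expR k%:R :> R by have := expR_ge1Dx (k%:R : R); lra.
  have k18 : k%:R ^+ 18 <= expR (18 * k%:R) :> R.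
    by rewrite expRM_natl lerXn2r ?nnegrE ?expR_ge0.
  have -> : err k = 6 * (m%:R ^+ 2 * (k%:R ^+ 18 * expR (- (24 * k%:R)))).
    by rewrite /err /block_cells natrM natrX natrM; ring.
  have t1 : k%:R ^+ 18 * expR (- (24 * k%:R)) <= expR (- (6 * k%:R)) :> R.
    apply: (@le_trans _ _ (expR (18 * k%:R) * expR (- (24 * k%:R)))).
      by rewrite ler_wpM2r// expR_ge0.
    by rewrite -expRD ler_expR; lra.
  have t2 : expR (- (6 * k%:R)) <= (6 * k%:R)^-1 :> R.
    rewrite expRN lef_pV2 ?posrE ?expR_gt0//; last by lra.
    by have := expR_ge1Dx (6 * k%:R : R); lra.
  apply: (@le_trans _ _ (6 * (m%:R ^+ 2 * (6 * k%:R)^-1))).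
    by rewrite ler_pM2l// ler_wpM2l ?sqr_ge0//; exact: le_trans t2.
  have -> : 6 * (m%:R ^+ 2 * (6 * k%:R)^-1) = m%:R ^+ 2 / k%:R :> R.
    by field; rewrite gt_eqF//; lra.
  by rewrite ler_pdivrMr; [rewrite mulrC|lra].
apply: filterS (@io_trials _ _ _ P (push eps) F (fun k => k%:R ^+ 2) p err eps e0 e1
  _ _ _ _ _ _ _ _) => //.
- move=> w io N; have [k [i [Nk itr Dw nF]]] := io (maxn 1 N).
  move: Nk; rewrite geq_max => /andP[k0 Nk]; exists k, i; split => //.
  by move: nF; rewrite /F k0.
- move=> B; have [K HK] := nat_eventually_ge B; exists (maxn 1 K) => k.
  rewrite geq_max => /andP[k0 /HK /le_trans]; apply.
  by rewrite expr2 ler_peMr// ler1n.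
- move=> k i; rewrite /F; case: ifP => // k0; by case: (bad k i k0).
- move=> k i j k0 ij; rewrite EFinM -{1}(Pc k i) -(Pc k j).
  apply: (increment_prob2 BM) => //; try exact: measurable_le.
  exact: mon.
- move=> k i k0; rewrite /F k0; have [_] := bad k i k0.
  by rewrite Pc -EFinM.
- move=> k k0; apply: (fine_normal_prob_ge BM ltr01); first exact: measurable_le.
  by apply: normal_prob_le; [rewrite sqrtr1|exact: pl0].
Qed.

(** Within a block ln t <= k^4 + 8 k, so [ae_growth] bounds [Q2] by a multiple of k^4, and the
    stretch of length k^8 is long enough for [q2_relaxation]. The push of 2 (1 - eps) k^2 then
    yields a dip of (1 - 2 eps) k^2, while sqrt (ln t) <= k^2 + 4. *)
Lemma ae_q1_dips (e : R) : 0 < beta -> 0 < y -> 0 < e -> e <= 1 ->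
  {ae P, forall w, forall M, exists2 t, M <= t & Q1 t w / Num.sqrt (ln t) <= -1 + e}.
Proof.
move=> b0 y0 ep e1.
have [m [m0 sm]] : exists m, (0 < m)%N /\ 336 / beta <= Num.sqrt m%:R.
  have [K HK] := sqrt_eventually_ge (336 / beta).
  by exists K.+1; split=> //; apply: HK.
have theta := theta_small b0 m0 sm.
pose eps := e / 4.
have e0 : 0 < eps by rewrite divr_gt0.
have eps1 : eps <= 1 by rewrite /eps; lra.
have := ae_growth BM sol b0 y0.
apply: filterS2 (ae_push m0 e0 eps1) => w pushes [M0 tame] M.
pose q := beta^-1; have q0 : 0 < q by rewrite invr_gt0.
have [K1 HK1] := nat_eventually_ge (Num.max M0 M).
(* The three thresholds ensure that 2 eps k^2 covers the relaxed queue, that k^8 exceeds the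
   relaxation time, and that the 4 in sqrt (ln t) <= k^2 + 4 is negligible. *)
have [K2 HK2] := nat_eventually_ge ((288 * q + 2 * beta) / (2 * eps)).
have [K3 HK3] := nat_eventually_ge (9 * (5 * 300) * q ^+ 2).
have [K4 HK4] := nat_eventually_ge (8 / e).
have [k [i [Kk ilt dev good]]] := pushes (maxn (maxn 1 K1) (maxn K2 (maxn K3 K4))).
move: Kk; rewrite !geq_max => /andP[/andP[k0 kK1] /andP[kK2 /andP[kK3 kK4]]].
have := HK1 k kK1; rewrite ge_max => /andP[kM0 kM].
have h2 := HK2 k kK2; have h3 := HK3 k kK3; have h4 := HK4 k kK4.
set z : R := k%:R in h2 h3 h4 kM0 kM.
have z1 : 1 <= z by rewrite /z ler1n.
have zz : z <= z ^+ 2 by rewrite expr2 ler_peMr//; lra.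
have z2 : 1 <= z ^+ 2 by lra.
have zexp : z <= expR ((z ^+ 2) ^+ 2).
  have := expR_ge1Dx ((z ^+ 2) ^+ 2); nra.
set s := block_start k i; set v := block_push k i.
have z80 : 0 <= z ^+ 8 by rewrite exprn_ge0//; lra.
have sge : expR ((z ^+ 2) ^+ 2) <= s by rewrite /s /block_start lerDl mulr_ge0// addr_ge0.
have svE : v - s = z ^+ 8 by rewrite /v /s /block_push -/z; ring.
have sv : s <= v by rewrite -subr_ge0 svE.
have s0 : 0 < s by apply: lt_le_trans sge; exact: expR_gt0.
pose lam := (z ^+ 2) ^+ 2 + 8 * z.
have vle : v + 1 <= expR lam.
  have [_ tr] := @truncn_expR R ((z ^+ 2) ^+ 2) (sqr_ge0 _).
  have itr : i.+1%:R <= expR ((z ^+ 2) ^+ 2).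
    by apply: le_trans tr; rewrite ler_nat.
  rewrite /v block_startS /block_start /lam expRD expRM_natl -/z.
  (* The offset and the i + 1 <= exp (k^4) blocks of length z^8 + 1 add up to at most exp (k^4) (z^8
     + 2). *)
  have z8 : z ^+ 8 + 2 <= (1 + z) ^+ 8.
    have sq2 (r a : R) : 0 <= r -> r + 2 <= a -> r ^+ 2 + 2 <= a ^+ 2.
      by move=> r0 ra; nra.
    have s1 : z ^+ 2 + 2 <= (1 + z) ^+ 2 by nra.
    have s2 := sq2 _ _ (sqr_ge0 z) s1.
    have s3 := sq2 _ _ (sqr_ge0 _) s2.
    by rewrite -!exprM in s3.
  apply: (@le_trans _ _ (expR ((z ^+ 2) ^+ 2) * (1 + z) ^+ 8)).
    have := expR_ge0 ((z ^+ 2) ^+ 2); nra.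
  rewrite ler_wpM2l ?expR_ge0// lerXn2r ?nnegrE ?expR_ge0//; first by lra.
  exact: expR_ge1Dx.
have lnle r : s <= r -> r <= v + 1 -> ln r <= lam.
  move=> sr rv; rewrite -[leRHS]expRK ler_ln ?posrE ?expR_gt0//.
    exact: le_trans vle.
  exact: lt_le_trans sr.
have q2m r : s <= r -> r <= v -> Q2 r w <= 300 / beta * lam.
  move=> sr rv.
  have [_ /le_trans] := tame r (le_trans kM0 (le_trans zexp (le_trans sge sr))); apply.
  apply: ler_wpM2l; first by rewrite divr_ge0 ?ler0n ?(ltW b0).
  apply: lnle => //.
  by apply: (le_trans rv); rewrite lerDl.
have len : 5 * (300 / beta * lam) / beta <= v - s.
  rewrite svE -/q.
  have -> : 5 * (300 * q * lam) * q = (5 * 300) * q ^+ 2 * lam by ring.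
  have lam9 : lam <= 9 * z ^+ 2 ^+ 2 by rewrite /lam; nra.
  have -> : z ^+ 8 = z ^+ 2 ^+ 2 * z ^+ 2 ^+ 2 by ring.
  have z4 : z <= z ^+ 2 ^+ 2 by nra.
  have h0 : 0 <= 5 * 300 :> R by rewrite mulr_ge0 ?ler0n.
  move: (5 * 300) h0 h3 => h h0 h3.
  have : h * q ^+ 2 * lam <= h * q ^+ 2 * (9 * z ^+ 2 ^+ 2).
    by rewrite ler_wpM2l// mulr_ge0// sqr_ge0.
  have := sqr_ge0 (z ^+ 2); nra.
have lam0 : 0 < z by lra.
have mod : linear_modulus (W ^~ w) z (56 * Num.sqrt m%:R^-1) s v.
  have mesh0 : 0 < @scale_mesh R m k by rewrite invr_gt0 ltr0n muln_gt0 k0.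
  have := grid_good_linear_modulus BM (ltW s0) mesh0 (ltW lam0) good.
  by rewrite block_mesh_cells// scale_mesh_level.
have fall : Num.sqrt 2 * (W (v + 1) w - W v w) <=
    - (2 * ((1 - 2 * eps) * z ^+ 2) + (288 * z / beta + 2 * beta)).
  have : W (v + 1) w - W v w <= - push_level eps k.
    by have := dev; rewrite /push /increment_in/= inE/= sqrtr1 mul1r.
  have s2E : Num.sqrt (2 : R) ^+ 2 = 2 by rewrite sqr_sqrtr.
  move=> /(ler_wpM2l (sqrtr_ge0 2)) /le_trans; apply.
  have -> : Num.sqrt 2 * - push_level eps k = - (2 * (1 - eps) * z ^+ 2).
    by rewrite /push_level -/z -[in RHS]s2E; ring.
  rewrite lerN2 -/q.
  move: h2; rewrite ler_pdivrMr; last by lra.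
  move=> h2.
  have -> : 288 * z * q = 288 * q * z by ring.
  move: (288 * q) h2 => h h2; nra.
have [t [vt tv q1t]] := q1_dip (sol w) b0 (ltW y0) lam0 theta (ltW s0) sv mod q2m len fall.
have st := le_trans sv vt.
exists t; first by apply: (le_trans kM); apply: (le_trans zexp); exact: le_trans sge st.
have lnt := lnle t st tv.
have lnt0 : 0 < ln t.
  apply: (@lt_le_trans _ _ (z ^+ 2 ^+ 2)); first by nra.
  by rewrite -[leLHS]expRK ler_ln ?posrE ?expR_gt0//; [exact: le_trans st|exact: lt_le_trans st].
have sq : Num.sqrt (ln t) <= z ^+ 2 + 4.
  have -> : z ^+ 2 + 4 = Num.sqrt ((z ^+ 2 + 4) ^+ 2) by rewrite sqrtr_sqr ger0_norm; lra.
  by rewrite ler_wsqrtr//; apply: (le_trans lnt); rewrite /lam; nra.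
have sq0 : 0 < Num.sqrt (ln t) by rewrite sqrtr_gt0.
rewrite ler_pdivrMr//.
move: h4; rewrite ler_pdivrMr// => h4.
move: q1t; rewrite /eps => q1t.
by nra.
Qed.

End idle_dips.

(** * From almost sure growth, peaks and dips to the limits *)

Theorem theorem2p2 (R : realType) :
  exists Cstar : R, 0 < Cstar /\
  forall (beta x y : R), 0 < beta -> x <= 0 -> 0 < y ->
  forall (d : measure_display) (T : measurableType d) (P : probability T R)
         (W Q1 Q2 L : R -> T -> R),
  std_brownian_motion P W ->
  (forall w, reflected_solution beta x y (fun t => W t w)
               (fun t => Q1 t w) (fun t => Q2 t w) (fun t => L t w)) ->
  {ae P, forall w,
     [/\ ((- (2 * Num.sqrt 2))%:E <=
            limf_einf (fun t : R => (Q1 t w / Num.sqrt (ln t))%:E) (pinfty_nbhs R))%E,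
         (limf_einf (fun t : R => (Q1 t w / Num.sqrt (ln t))%:E) (pinfty_nbhs R)
            <= (-1)%:E)%E,
         ((beta^-1)%:E <=
            limf_esup (fun t : R => (Q2 t w / ln t)%:E) (pinfty_nbhs R))%E &
         (limf_esup (fun t : R => (Q2 t w / ln t)%:E) (pinfty_nbhs R)
            <= (2 / (Cstar * beta))%:E)%E]}.
Proof.
(* With this value 2 / (Cstar beta) is the 300 / beta of [ae_growth]. *)
exists 150^-1; split=> // beta x y b0 _ y0 d T P W Q1 Q2 L BM sol.
(* The errors 1 / (j + 1) form a countable family, so a single null set serves for all of them. *)
have dips : {ae P, forall w, forall j M,
    exists2 t, M <= t & Q1 t w / Num.sqrt (ln t) <= -1 + j.+1%:R^-1}.
  apply: ae_foralln => j; apply: (ae_q1_dips BM sol) => //.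
  by rewrite invf_le1 ?ltr0n// ler1n.
have peaks : {ae P, forall w, forall j M,
    exists2 t, M <= t & beta^-1 - j.+1%:R^-1 <= Q2 t w / ln t}.
  by apply: ae_foralln => j; apply: (ae_q2_peaks BM sol).
have small (e : R) : 0 < e -> exists j : nat, j.+1%:R^-1 <= e.
  move=> e0; have [K HK] := nat_eventually_ge e^-1; exists K.
  rewrite -[leRHS]invrK lef_pV2 ?posrE ?invr_gt0//.
  exact: HK (leqnSn K).
have ln_pos (t : R) : expR 1 <= t -> 0 < ln t.
  move=> et; apply: lt_le_trans ltr01 _.
  rewrite -[leLHS]expRK ler_ln ?posrE ?expR_gt0//.
  by apply: lt_le_trans et; exact: expR_gt0.
have growth := ae_growth BM sol b0 y0.
apply: filterS3 dips peaks growth => w dip peak [M tame]; split.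
- apply: limf_einf_ge; exists (Num.max M (expR 1)) => t; rewrite ge_max => /andP[Mt et].
  by rewrite ler_pdivlMr ?sqrtr_gt0 ?ln_pos//; case: (tame t Mt).
- apply: limf_einf_le => e e0 M'; have [j je] := small e e0.
  have [t Mt qt] := dip j M'; exists t => //; apply: le_trans qt _.
  by rewrite lerD2l.
- apply: limf_esup_ge => e e0 M'; have [j je] := small e e0.
  have [t Mt qt] := peak j M'; exists t => //; apply: le_trans qt.
  by rewrite lerD2l lerN2.
- apply: limf_esup_le; exists (Num.max M (expR 1)) => t; rewrite ge_max => /andP[Mt et].
  rewrite ler_pdivrMr ?ln_pos//.
  have -> : 2 / (150^-1 * beta) = 300 / beta by field; rewrite gt_eqF.
  by case: (tame t Mt).
Qed.
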